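(* For each $n\ge 0$ let $X$ be a random symmetric $n\times n$ real matrix whose entries on or above the diagonal, $\{X_{ij}: 1\le i\le j\le n\}$, are i.i.d. with a common distribution (arbitrary, not depending on $n$, with finite fourth moment), and $X_{ji}=X_{ij}$. Let $m_1=\mathbb{E}[X_{ij}]$ and $\mu_q=\mathbb{E}[(X_{ij}-m_1)^q]$ for $q=2,3,4$, let $f_2(n)=\mathbb{E}[\det(X)^2]$ and $F_2(t)=\sum_{n=0}^{\infty} f_2(n)\frac{t^n}{n!}$. Then $$F_2(t) = \left(1+2 m_1 \mu_3 t^2+m_1^2 \left(\mu_3^2t^4+\frac{t}{1-\mu_2^2 t^2}+\frac{2 \mu_2 t^2}{1-\mu_2 t}\right)\right) \frac{\exp\left(\frac{(\mu_4-3\mu_2^2) t^2}{2}-\mu_2 t\right)}{\left(1-\mu_2 t\right)^2 \sqrt{1-\mu_2^2 t^2}}.$$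
   Context: The identity is an identity of formal power series in $t$; $\frac{1}{\sqrt{1-x}}$ denotes the power series with constant term $1$. The determinant of the $0\times 0$ matrix is $1$, so $f_2(0)=1$. *)

(* Defs.v *)
From HB Require Import structures.
From mathcomp Require Import all_boot all_order all_algebra.
From mathcomp Require Import all_classical all_reals all_analysis.
From mathcomp Require Import zify ring.

Set Implicit Arguments.
Unset Strict Implicit.
Unset Printing Implicit Defensive.

Import Order.TTheory GRing.Theory Num.Theory.
Local Open Scope classical_set_scope.
Local Open Scope ring_scope.

(* formal power series, with the Cauchy product; [fcoef f n] is the coefficient
   of degree n *)
Record fps (K : fieldType) := Fps { fcoef : nat -> K }.

HB.instance Definition _ (K : fieldType) := gen_eqMixin (fps K).
HB.instance Definition _ (K : fieldType) := gen_choiceMixin (fps K).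

Section FpsRing.
Variable K : fieldType.
Implicit Types (f g h : fps K) (p q : {poly K}) (a b : K).

Lemma fpsP f g : (forall n, fcoef f n = fcoef g n) <-> f = g.
Proof.
split=> [|-> //]; case: f g => [f] [g] /= fg.
by congr Fps; apply/funext.
Qed.

Definition fzero : fps K := Fps (fun=> 0).
Definition fopp f : fps K := Fps (fun n => - fcoef f n).
Definition fadd f g : fps K := Fps (fun n => fcoef f n + fcoef g n).
Definition fone : fps K := Fps (fun n => (n == 0%N)%:R).
Definition fmul f g : fps K :=
  Fps (fun n => \sum_(i < n.+1) fcoef f i * fcoef g (n - i)%N).
Definition fscale a f : fps K := Fps (fun n => a * fcoef f n).

Fact faddA : associative fadd.
Proof. by move=> f g h; apply/fpsP => n /=; rewrite addrA. Qed.
Fact faddC : commutative fadd.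
Proof. by move=> f g; apply/fpsP => n /=; rewrite addrC. Qed.
Fact fadd0 : left_id fzero fadd.
Proof. by move=> f; apply/fpsP => n /=; rewrite add0r. Qed.
Fact faddN : left_inverse fzero fopp fadd.
Proof. by move=> f; apply/fpsP => n /=; rewrite addNr. Qed.

HB.instance Definition _ :=
  GRing.isZmodule.Build (fps K) faddA faddC fadd0 faddN.

Definition ftrunc N f : {poly K} := \poly_(i < N.+1) fcoef f i.

Lemma coef_ftrunc N f n : (n <= N)%N -> (ftrunc N f)`_n = fcoef f n.
Proof. by move=> nN; rewrite coef_poly ltnS nN. Qed.

Lemma fmul_trunc N p q f g n : (n <= N)%N ->
  (forall i, (i <= N)%N -> p`_i = fcoef f i) ->
  (forall i, (i <= N)%N -> q`_i = fcoef g i) ->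
  (p * q)`_n = fcoef (fmul f g) n.
Proof.
move=> nN Hp Hq; rewrite coefM; apply: eq_bigr => i _.
rewrite Hp ?Hq //; first by rewrite (leq_trans (leq_subr _ _)).
by rewrite (leq_trans _ nN) // -ltnS.
Qed.

Fact fmulA : associative fmul.
Proof.
move=> f g h; apply/fpsP => n.
have tr k := @coef_ftrunc n k.
rewrite -(@fmul_trunc n (ftrunc n f) (ftrunc n g * ftrunc n h)) //; last first.
- by move=> i iN; apply: (@fmul_trunc n) => // j; apply: tr.
- by move=> i; apply: tr.
rewrite mulrA; apply: (@fmul_trunc n) => // i iN; last exact: tr.
by apply: (@fmul_trunc n) => // j; apply: tr.
Qed.

Fact fmulC : commutative fmul.
Proof.
move=> f g; apply/fpsP => n.
have tr k := @coef_ftrunc n k.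
transitivity ((ftrunc n f * ftrunc n g)`_n).
  by symmetry; apply: (@fmul_trunc n) => // i; apply: tr.
by rewrite mulrC; apply: (@fmul_trunc n) => // i; apply: tr.
Qed.

Fact fmul1 : left_id fone fmul.
Proof.
move=> f; apply/fpsP => n /=.
rewrite big_ord_recl /= mul1r subn0 big1 ?addr0 // => i _.
by rewrite mul0r.
Qed.

Fact fmulDl : left_distributive fmul fadd.
Proof.
move=> f g h; apply/fpsP => n /=; rewrite -big_split /=.
by apply: eq_bigr => i _; rewrite mulrDl.
Qed.

Fact fone_neq0 : fone != fzero.
Proof.
by apply/eqP => /fpsP /(_ 0%N) /= /eqP; rewrite oner_eq0.
Qed.

HB.instance Definition _ := GRing.Zmodule_isComNzRing.Build (fps K)
  fmulA fmulC fmul1 fmulDl fone_neq0.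

Fact fscaleA a b f : fscale a (fscale b f) = fscale (a * b) f.
Proof. by apply/fpsP => n /=; rewrite mulrA. Qed.
Fact fscale1 : left_id 1 fscale.
Proof. by move=> f; apply/fpsP => n /=; rewrite mul1r. Qed.
Fact fscaleDr : right_distributive fscale +%R.
Proof. by move=> a f g; apply/fpsP => n /=; rewrite mulrDr. Qed.
Fact fscaleDl f : {morph fscale^~ f : a b / a + b}.
Proof. by move=> a b; apply/fpsP => n /=; rewrite mulrDl. Qed.

HB.instance Definition _ := GRing.Zmodule_isLmodule.Build K (fps K)
  fscaleA fscale1 fscaleDr fscaleDl.

Fact fscaleAl a f g : a *: (f * g) = (a *: f) * g.
Proof.
apply/fpsP => n /=; rewrite mulr_sumr; apply: eq_bigr => i _.
by rewrite mulrA.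
Qed.

HB.instance Definition _ := GRing.Lmodule_isLalgebra.Build K (fps K) fscaleAl.
HB.instance Definition _ := GRing.Lalgebra_isComAlgebra.Build K (fps K).

Lemma fcoefD f g n : fcoef (f + g) n = fcoef f n + fcoef g n.
Proof. by []. Qed.
Lemma fcoefN f n : fcoef (- f) n = - fcoef f n.
Proof. by []. Qed.
Lemma fcoefB f g n : fcoef (f - g) n = fcoef f n - fcoef g n.
Proof. by []. Qed.
Lemma fcoef0 n : fcoef (0 : fps K) n = 0.
Proof. by []. Qed.
Lemma fcoef1 n : fcoef (1 : fps K) n = (n == 0%N)%:R.
Proof. by []. Qed.
Lemma fcoefZ a f n : fcoef (a *: f) n = a * fcoef f n.
Proof. by []. Qed.
Lemma fcoefM f g n :
  fcoef (f * g) n = \sum_(i < n.+1) fcoef f i * fcoef g (n - i)%N.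
Proof. by []. Qed.
Lemma fcoef_sum (I : Type) (r : seq I) (Q : pred I) (F : I -> fps K) n :
  fcoef (\sum_(i <- r | Q i) F i) n = \sum_(i <- r | Q i) fcoef (F i) n.
Proof. by apply: (big_morph (fun f => fcoef f n)). Qed.

Lemma fcoefM0 f g : fcoef (f * g) 0 = fcoef f 0 * fcoef g 0.
Proof. by rewrite fcoefM big_ord1. Qed.

Lemma fcoef_exp_lt f k n :
  fcoef f 0 = 0 -> (n < k)%N -> fcoef (f ^+ k) n = 0.
Proof.
move=> f0; elim: k n => // k IH n nk.
rewrite exprS fcoefM big_ord_recl /= f0 mul0r add0r big1 // => i _.
by rewrite IH ?mulr0 // /bump /=; have := ltn_ord i; lia.
Qed.

Definition fX : fps K := Fps (fun n => (n == 1%N)%:R).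

(* h(u); the sum over k may be cut at k = n because the notion is only
   meaningful when u has zero constant term, in which case u ^+ k has no term
   of degree n for k > n *)
Definition fcomp h u : fps K :=
  Fps (fun n => \sum_(k < n.+1) fcoef h k * fcoef (u ^+ k) n).

Lemma fcompE h u n N : fcoef u 0 = 0 -> (n <= N)%N ->
  fcoef (fcomp h u) n = fcoef (\sum_(k < N.+1) fcoef h k *: u ^+ k) n.
Proof.
move=> u0 nN; rewrite fcoef_sum /=.
rewrite (big_ord_widen N.+1 (fun k => fcoef h k * fcoef (u ^+ k) n)) //.
rewrite big_mkcond; apply: eq_bigr => i _; rewrite ltnS.
by case: leqP => // ni; rewrite fcoef_exp_lt ?mulr0.
Qed.

Definition fgeom : fps K := Fps (fun=> 1).

Lemma fgeomK u : fcoef u 0 = 0 -> fcomp fgeom u * (1 - u) = 1.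
Proof.
move=> u0; apply/fpsP => n.
have -> : fcoef (fcomp fgeom u * (1 - u)) n =
          fcoef ((\sum_(k < n.+1) u ^+ k) * (1 - u)) n.
  rewrite !fcoefM; apply: eq_bigr => i _; congr (_ * _).
  rewrite (@fcompE _ _ _ n) //; last by rewrite -ltnS.
  by congr fcoef; apply: eq_bigr => k _; rewrite scale1r.
have -> : (\sum_(k < n.+1) u ^+ k) * (1 - u) = 1 - u ^+ n.+1.
  by rewrite -[1 - u ^+ _]opprB subrX1 mulrC -mulNr opprB.
by rewrite fcoefB fcoef_exp_lt // subr0.
Qed.

Definition funit : {pred fps K} := fun f => fcoef f 0 != 0.
Definition finv f : fps K :=
  if f \in funit then
    (fcoef f 0)^-1 *: fcomp fgeom (1 - (fcoef f 0)^-1 *: f)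
  else f.

Fact fmulVf : {in funit, left_inverse 1 finv *%R}.
Proof.
move=> f uf; rewrite /finv uf -scalerAl scalerAr.
have := @fgeomK (1 - (fcoef f 0)^-1 *: f).
rewrite [1 - (1 - _)]subKr; apply.
by rewrite fcoefB fcoefZ fcoef1 mulVf ?subrr.
Qed.

Fact funitP f g : g * f = 1 -> funit f.
Proof.
move=> /fpsP /(_ 0%N); rewrite fcoefM0 fcoef1 /funit => gf.
by apply/eqP => f0; move: gf; rewrite f0 mulr0 => /eqP; rewrite eq_sym oner_eq0.
Qed.

Fact finv_out : {in [predC funit], finv =1 id}.
Proof. by move=> f /negbTE nf; rewrite /finv nf. Qed.

HB.instance Definition _ := GRing.ComNzRing_hasMulInverse.Build (fps K)
  fmulVf funitP finv_out.

Lemma fps_unitE f : (f \is a GRing.unit) = (fcoef f 0 != 0).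
Proof. by []. Qed.

End FpsRing.

Arguments fX {K}.

Section FpsSeries.
Variable K : numFieldType.
Implicit Types (f g u : fps K).

Definition egf (a : nat -> K) : fps K := Fps (fun n => a n / n`!%:R).

Definition fexp u : fps K := fcomp (egf (fun=> 1)) u.

(* Newton's series of (1 - x)^(-1/2); [fisqrt1mP] and [fisqrt1m_uniq]
   characterize it as the inverse square root of 1 - x with constant term 1 *)
Definition fisqrt1m : fps K := Fps (fun n => 'C(n.*2, n)%:R / 4 ^+ n).

(* 1 / sqrt (1 - u), for u with zero constant term *)
Definition frsqrt1m u : fps K := fcomp fisqrt1m u.

Lemma fisqrt1m_rec n :
  fcoef fisqrt1m n.+1 * n.+1%:R *+ 2 = fcoef fisqrt1m n * n.*2.+1%:R.
Proof.
have E : (n.+1 * 'C(n.+1.*2, n.+1) = 2 * (n.*2.+1 * 'C(n.*2, n)))%N.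
  apply/eqP; rewrite -(eqn_pmul2l (ltn0Sn n)); apply/eqP.
  have E1 := mul_bin_diag n.+1.*2 n; have E2 := mul_bin_down n.*2.+1 n.
  rewrite doubleS /= in E1 *.
  have e : (n.*2.+1 - n = n.+1)%N by rewrite -addnn; lia.
  rewrite e /= in E2; rewrite -E1 E2 -!muln2; nia.
have {}E : n.+1%:R * 'C(n.+1.*2, n.+1)%:R =
    2 * (n.*2.+1%:R * 'C(n.*2, n)%:R) :> K by rewrite -!natrM E.
rewrite /= exprS invfM.
have -> : 'C(n.+1.*2, n.+1)%:R * (4^-1 / 4 ^+ n) * n.+1%:R =
   (n.+1%:R * 'C(n.+1.*2, n.+1)%:R) * (4^-1 / 4 ^+ n) :> K by ring.
rewrite E -mulr_natr.
have n4 : (4 : K) ^+ n != 0 by rewrite expf_neq0 ?pnatr_eq0.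
by move: (4 ^+ n) n4 => p n4; field.
Qed.

Lemma fisqrt1m_sqr n : fcoef (fisqrt1m ^+ 2) n = 1.
Proof.
pose c := fcoef fisqrt1m; pose S n := \sum_(i < n.+1) c i * c (n - i)%N.
have sym m : \sum_(i < m.+1) (c i * i%:R *+ 2) * c (m - i)%N = m%:R * S m.
  have E : \sum_(i < m.+1) c i * i%:R * c (m - i)%N =
           \sum_(i < m.+1) c i * (m - i)%:R * c (m - i)%N.
    rewrite (reindex_inj rev_ord_inj) /=; apply: eq_bigr => i _.
    rewrite subSS subKn; last by rewrite -ltnS.
    by rewrite mulrAC [c (m - i)%N * _]mulrC mulrAC.
  transitivity (\sum_(i < m.+1) c i * i%:R * c (m - i)%N +
                \sum_(i < m.+1) c i * i%:R * c (m - i)%N).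
    by rewrite -big_split; apply: eq_bigr => i _; rewrite mulr2n mulrDl.
  rewrite {2}E -big_split /S mulr_sumr; apply: eq_bigr => i _ /=.
  rewrite -mulrDl -mulrDr -natrD subnKC; last by rewrite -ltnS.
  by rewrite [c i * _]mulrC mulrA.
have Srec m : S m.+1 = S m.
  apply: (@mulfI _ m.+1%:R); first by rewrite pnatr_eq0.
  rewrite -sym big_ord_recl /= mulr0 mul0rn mul0r add0r.
  under eq_bigr => i _ do rewrite /bump add1n subSS /c fisqrt1m_rec.
  rewrite -natr1 mulrDl mul1r -sym [X in _ = _ + X]/S -big_split.
  apply: eq_bigr => i _; rewrite -/(c i) -/(c (m - i)%N) [RHS]/=.
  have -> : i.*2.+1%:R = 2 * i%:R + 1 :> K by rewrite -natr1 -mul2n natrM.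
  by ring.
rewrite expr2 fcoefM -/c -/(S n); elim: n => [|n IH]; last by rewrite Srec.
by rewrite /S big_ord1 /c /= !bin0 expr0 divr1 mulr1.
Qed.

Lemma fisqrt1mP : fcoef fisqrt1m 0 = 1 /\ fisqrt1m ^+ 2 * (1 - fX) = 1.
Proof.
split; first by rewrite /= bin0 expr0 divr1.
have -> : fisqrt1m ^+ 2 = fgeom K by apply/fpsP => n; rewrite fisqrt1m_sqr.
have X0 : fcoef (@fX K) 0 = 0 by [].
rewrite -[RHS](fgeomK X0); congr (_ * _); apply/fpsP => n /=.
suff Xn k m : fcoef ((fX : fps K) ^+ k) m = (m == k)%:R.
  rewrite (bigD1 ord_max) //= Xn eqxx mulr1 big1 ?addr0 // => i ni.
  rewrite Xn; move: ni; rewrite -(inj_eq val_inj) /= eq_sym => /negbTE->.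
  by rewrite mulr0.
elim: k m => [|k IH] m; first by rewrite expr0 fcoef1.
case: m => [|m]; first by rewrite exprS fcoefM0 X0 mul0r.
rewrite exprS fcoefM big_ord_recl /= mul0r add0r big_ord_recl /= mul1r.
by rewrite big1 ?addr0 ?subSS ?subn0 ?IH // => i _; rewrite /= mul0r.
Qed.

Lemma fisqrt1m_uniq g :
  fcoef g 0 = 1 -> g ^+ 2 * (1 - fX) = 1 -> g = fisqrt1m.
Proof.
case: fisqrt1mP => h0 hX g0 gX.
have uX : (1 - fX : fps K) \is a GRing.unit.
  by rewrite fps_unitE fcoefB /= subr0 oner_eq0.
have gh : (g - fisqrt1m) * (g + fisqrt1m) = 0.
  by rewrite -subr_sqr; apply: (mulIr uX); rewrite mulrBl gX hX subrr mul0r.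
have u2 : g + fisqrt1m \is a GRing.unit.
  by rewrite fps_unitE fcoefD g0 h0 -(natrD _ 1 1) pnatr_eq0.
apply/eqP; rewrite -subr_eq0; apply/eqP.
by apply: (mulIr u2); rewrite gh mul0r.
Qed.

End FpsSeries.

Section RandomVariables.
Context {R : realType}.

Definition mutually_independent d (T : measurableType d) (P : probability T R)
    (I : finType) (Y : I -> T -> R) : Prop :=
  forall (J : {set I}) (B : I -> set R), (forall i, measurable (B i)) ->
    P (\bigcap_(i in [set` J]) (Y i @^-1` B i)) =
    (\prod_(i in J) P (Y i @^-1` B i))%E.

(* moments of a random variable of law D; [fine] loses nothing as soon as D has
   enough finite moments *)
Definition mean (D : probability (measurableTypeR R) R) : R :=
  fine ('E_D[fun x : R => x])%E.

Definition central_moment (D : probability (measurableTypeR R) R) (q : nat) : R :=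
  fine ('E_D[fun x : R => ((x - mean D) ^+ q)%R])%E.

(* the entries on or above the diagonal are indexed by the pairs i <= j *)
Definition symmetric_iid d (T : measurableType d) (P : probability T R)
    (D : probability (measurableTypeR R) R) n
    (X : 'I_n -> 'I_n -> {RV P >-> R}) : Prop :=
  [/\ forall i j, X j i =1 X i j,
      forall (i j : 'I_n) (B : set R), (i <= j)%N -> measurable B ->
        distribution P (X i j) B = D B
    & mutually_independent P
        (fun p : {p : 'I_n * 'I_n | (p.1 <= p.2)%N} =>
           X (val p).1 (val p).2 : T -> R)].

Definition det_sqr d (T : measurableType d) (P : probability T R) n
    (X : 'I_n -> 'I_n -> {RV P >-> R}) (w : T) : R :=
  (\det (\matrix_(i, j) X i j w)) ^+ 2.

End RandomVariables.

(* Main.v *)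
Require Import Defs.
From mathcomp Require Import all_boot all_order all_algebra all_fingroup.
From mathcomp Require Import all_classical all_reals all_analysis measurable_realfun.
From mathcomp Require Import finmap zify ring lra.

Set Implicit Arguments.
Unset Strict Implicit.
Unset Printing Implicit Defensive.

Import Order.TTheory GRing.Theory Num.Theory.
Local Open Scope classical_set_scope.
Local Open Scope ring_scope.

(** The second moment of the determinant only involves the moments of order at
    most 4 of the entries, so their law may be replaced by a signed measure on
    five points with the same moments; expectations become finite sums.
    Subtracting the mean, [X = Y + m1 J] gives [det X = det Y + m1 (1 adj(Y) 1)],
    where [1 adj(Y) 1] is minus the determinant of [Y] bordered by a row of ones.
    Expanding along the first row of the centered matrix [Y], and bringing any
    index to the front by exchangeability, yields linear recursions between the
    expectations of [det^2], [(tr adj)^2], [sum_ij adj_ij^2],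
    [det * (1 adj 1)] and [(1 adj 1)^2]. For the generating functions they are
    algebraic relations together with one first-order linear differential
    equation, which the stated product of series also satisfies. *)

(** The recursions close because a bordered matrix depends on its border with low degree: the
    determinant is affine in the corner and quadratic in the border row, and the first-row entries
    of the adjugate are at most linear in that row. Averaging the border out of a product of two
    such quantities leaves traces, sums and squares built from the adjugate of the inner block. The
    square of a quadratic form is where the fourth cumulant [mu4 - 3 * mu2 ^+ 2] enters. Adjugates
    take the place of inverses, so the identities are polynomial, hold for singular matrices and
    make sense over any commutative ring. Prescribing four moments on five fixed nodes may force
    negative weights, whence a signed measure; the computation relies on linearity of [ex] alone.
    Integration theory serves only to show that the expectation of the squared determinant is a
    polynomial in the raw moments, the same one as for the five-point measure. *)

(** * Bordered matrices and their adjugates *)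

Section Bordering.
Variable K : comNzRingType.
Implicit Types (n : nat) (a : K).

Definition bord n a (u : 'rV[K]_n) (Z : 'M[K]_n) : 'M[K]_n.+1 :=
  \matrix_(i, j) match unlift ord0 i, unlift ord0 j with
    | None, None => a
    | None, Some j' => u 0 j'
    | Some i', None => u 0 i'
    | Some i', Some j' => Z i' j'
    end.

Definition rcons0 n a (u : 'rV[K]_n) : 'rV[K]_n.+1 :=
  \row_i oapp (u 0) a (unlift ord0 i).

Lemma rcons00 n a (u : 'rV[K]_n) : rcons0 a u 0 ord0 = a.
Proof. by rewrite mxE unlift_none. Qed.

Lemma rcons0_lift n a (u : 'rV[K]_n) j : rcons0 a u 0 (lift ord0 j) = u 0 j.
Proof. by rewrite mxE liftK. Qed.

Lemma bord00 n a (u : 'rV[K]_n) Z : bord a u Z ord0 ord0 = a.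
Proof. by rewrite mxE unlift_none. Qed.

Lemma bord0l n a (u : 'rV[K]_n) Z j : bord a u Z ord0 (lift ord0 j) = u 0 j.
Proof. by rewrite mxE unlift_none liftK. Qed.

Lemma bordl0 n a (u : 'rV[K]_n) Z j : bord a u Z (lift ord0 j) ord0 = u 0 j.
Proof. by rewrite mxE unlift_none liftK. Qed.

Lemma bordll n a (u : 'rV[K]_n) Z i j :
  bord a u Z (lift ord0 i) (lift ord0 j) = Z i j.
Proof. by rewrite mxE !liftK. Qed.

Definition bordE := (bord00, bord0l, bordl0, bordll).

Lemma tr_bord n a (u : 'rV[K]_n) Z : (bord a u Z)^T = bord a u Z^T.
Proof.
apply/matrixP => i j; rewrite mxE.
by case: (unliftP ord0 i) => [i'|] ->; case: (unliftP ord0 j) => [j'|] ->;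
  rewrite !bordE // mxE.
Qed.

Lemma cofactor_bord0 n a (u : 'rV[K]_n) Z :
  cofactor (bord a u Z) ord0 ord0 = \det Z.
Proof.
rewrite /cofactor addn0 expr0 mul1r; congr (\det _).
by apply/matrixP => i j; rewrite !mxE !liftK.
Qed.

(** Without the border row and the column of [k], the first column left is [u]; expanding along it
    yields cofactors of [Z]. The minus sign comes from the shift of [k] by one caused by the
    border. *)
Lemma cofactor_bord n a (u : 'rV[K]_n) Z k :
  cofactor (bord a u Z) ord0 (lift ord0 k) = - \sum_i u 0 i * \adj Z k i.
Proof.
case: n u Z k => [|n] u Z k; first by case: k.
set h : 'I_n.+2 := lift ord0 k.
pose M : 'M[K]_(n.+1) := row' ord0 (col' h (bord a u Z)).
rewrite /cofactor -/M (expand_det_col M ord0) mulr_sumr -sumrN.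
apply: eq_bigr => i _.
have -> : M i ord0 = u 0 i.
  rewrite !mxE liftK.
  by rewrite (_ : lift h (ord0 : 'I_n.+1) = ord0) ?unlift_none //; exact: val_inj.
rewrite mxE /cofactor.
have -> : row' i (col' ord0 M) = row' i (col' k Z).
  apply/matrixP => p q; rewrite !mxE liftK.
  rewrite (_ : lift h (lift ord0 q) = lift ord0 (lift k q)) ?liftK //.
  by apply: val_inj; rewrite /= /bump; lia.
rewrite addn0 /= /bump add0n add1n exprS exprD; ring.
Qed.

Lemma adj_bord00 n a (u : 'rV[K]_n) Z : \adj (bord a u Z) ord0 ord0 = \det Z.
Proof. by rewrite mxE cofactor_bord0. Qed.

Lemma adj_bord0l n a (u : 'rV[K]_n) Z k :
  \adj (bord a u Z) ord0 (lift ord0 k) = - \sum_i u 0 i * \adj Z i k.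
Proof.
rewrite mxE -cofactor_tr tr_bord cofactor_bord -trmx_adj.
by congr (- _); apply: eq_bigr => i _; rewrite mxE.
Qed.

Definition qform n (u : 'rV[K]_n) (Z : 'M[K]_n) : K :=
  \sum_i \sum_j u 0 i * u 0 j * Z i j.

Lemma det_bord n a (u : 'rV[K]_n) Z :
  \det (bord a u Z) = a * \det Z - qform u (\adj Z).
Proof.
rewrite (expand_det_row _ ord0) big_ord_recl bord00 cofactor_bord0.
congr (_ + _); rewrite -sumrN; apply: eq_bigr => k _.
rewrite bord0l cofactor_bord mulrN mulr_sumr; congr (- _).
by apply: eq_bigr => i _; rewrite mulrA.
Qed.

Definition sumadj n (Z : 'M[K]_n) : K := \sum_i \sum_j \adj Z i j.

Definition minor n (p : 'I_n.+1) (Z : 'M[K]_n.+1) : 'M[K]_n :=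
  row' p (col' p Z).

Lemma minor_bord n (p : 'I_n.+1) a (u : 'rV[K]_n.+1) Z :
  minor (lift ord0 p) (bord a u Z) = bord a (col' p u) (minor p Z).
Proof.
have l0 : lift (lift ord0 p) ord0 = ord0 :> 'I_n.+2 by apply: val_inj.
have ll (j : 'I_n) : lift (lift ord0 p) (lift ord0 j) = lift ord0 (lift p j).
  by apply: val_inj; rewrite /= /bump; lia.
apply/matrixP => i j; rewrite !mxE.
by case: (unliftP ord0 i) => [i'|] ->; case: (unliftP ord0 j) => [j'|] ->;
  rewrite ?unlift_none ?liftK ?l0 ?ll ?liftK ?unlift_none // !mxE.
Qed.

Lemma adj_diag n (p : 'I_n.+1) (Z : 'M[K]_n.+1) :
  \adj Z p p = \det (minor p Z).
Proof. by rewrite mxE /cofactor -signr_odd addnn odd_double mul1r. Qed.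

Definition lform n (u : 'rV[K]_n) (l : 'I_n -> K) : K := \sum_i u 0 i * l i.

Lemma lform_rcons n a (u : 'rV[K]_n) l :
  lform (rcons0 a u) l = a * l ord0 + lform u (fun i => l (lift ord0 i)).
Proof.
rewrite /lform big_ord_recl rcons00; congr (_ + _).
by apply: eq_bigr => i _; rewrite rcons0_lift.
Qed.

Lemma qform_rcons n a (u : 'rV[K]_n) (Z : 'M[K]_n.+1) :
  qform (rcons0 a u) Z = a ^+ 2 * Z ord0 ord0 +
    a * lform u (fun j => Z ord0 (lift ord0 j) + Z (lift ord0 j) ord0) +
    qform u (minor ord0 Z).
Proof.
rewrite /lform /qform big_ord_recl big_ord_recl rcons00 -expr2 -!addrA; congr (_ + _).
transitivity (\sum_j a * (u 0 j * Z ord0 (lift ord0 j)) +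
  (\sum_j a * (u 0 j * Z (lift ord0 j) ord0) +
   \sum_i \sum_j u 0 i * u 0 j * minor ord0 Z i j)).
  congr (_ + _); first by apply: eq_bigr => j _; rewrite rcons0_lift mulrA.
  rewrite -big_split; apply: eq_bigr => i _; rewrite big_ord_recl /=.
  rewrite rcons00 !rcons0_lift mulrA [a * _]mulrC; congr (_ + _).
  by apply: eq_bigr => j _; rewrite rcons0_lift !mxE.
rewrite addrA -big_split /= mulr_sumr; congr (_ + _).
by apply: eq_bigr => j _; rewrite -mulrDr -mulrDr.
Qed.

Lemma det_bord1 n (Z : 'M[K]_n) : \det (bord 0 (const_mx 1) Z) = - sumadj Z.
Proof.
rewrite det_bord mul0r sub0r /qform; congr (- _).
by apply: eq_bigr => i _; apply: eq_bigr => j _; rewrite !mxE !mul1r.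
Qed.

(** The scalar [b] is the entry where the two borders cross. Exchanging the first two indices in
    rows and columns at once multiplies the determinant by the square of a sign. *)
Lemma swap_bord n a b c (u v : 'rV[K]_n) Z :
  \det (bord a (rcons0 b u) (bord c v Z)) =
  \det (bord c (rcons0 b v) (bord a u Z)).
Proof.
have -> : bord c (rcons0 b v) (bord a u Z) =
  xrow ord0 (lift ord0 ord0) (xcol ord0 (lift ord0 ord0)
    (bord a (rcons0 b u) (bord c v Z))).
  have t k : tperm ord0 (lift ord0 ord0) (lift ord0 (lift ord0 k)) =
      lift ord0 (lift ord0 k) :> 'I_n.+2 by rewrite tpermD.
  apply/matrixP => i j; rewrite [RHS]mxE [RHS]mxE.
  case: (unliftP ord0 i) => [i'|] ->; case: (unliftP ord0 j) => [j'|] ->;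
  rewrite ?tpermL; try (case: (unliftP ord0 i') => [i''|] ->);
  try (case: (unliftP ord0 j') => [j''|] ->);
  by rewrite ?tpermL ?tpermR ?t !bordE ?rcons00 ?rcons0_lift ?bordE.
rewrite xrowE xcolE !det_mulmx det_perm odd_tperm /= expr1; ring.
Qed.

(* The Schur complement of a double bordering, by a row of ones and by [u]. *)
Lemma sumadj_bord n a (u : 'rV[K]_n) Z :
  sumadj (bord a u Z) = a * sumadj Z + \det Z
    - lform u (fun i => \sum_j (\adj Z i j + \adj Z j i))
    + qform u (minor ord0 (\adj (bord 0 (const_mx 1) Z))).
Proof.
have c1 : const_mx 1 = rcons0 1 (const_mx 1) :> 'rV[K]_n.+1.
  by apply/rowP => i; rewrite !mxE; case: unliftP => [j|] _ //=; rewrite mxE.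
apply: oppr_inj; rewrite -det_bord1 c1 swap_bord det_bord qform_rcons.
rewrite det_bord1 adj_bord00.
rewrite /lform (eq_bigr (fun i => - (u 0 i * \sum_j (\adj Z i j + \adj Z j i)))).
  by rewrite sumrN; ring.
move=> i _; rewrite adj_bord0l mxE cofactor_bord -opprD mulrN; congr (- (_ * _)).
rewrite addrC -big_split /=.
by apply: eq_bigr => j _; rewrite mxE !mul1r.
Qed.

Lemma adj_bord1_diag n (Z : 'M[K]_n.+1) p :
  \adj (bord 0 (const_mx 1) Z) (lift ord0 p) (lift ord0 p) =
  - sumadj (minor p Z).
Proof. by rewrite adj_diag minor_bord col'_const det_bord1. Qed.

End Bordering.

(** * Simultaneous permutations of rows and columns *)

Section Conjugation.
Variable K : comNzRingType.

Definition conj_perm n (s : 'S_n) (M : 'M[K]_n) : 'M[K]_n :=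
  \matrix_(i, j) M (s i) (s j).

Lemma det_conj_perm n (s : 'S_n) (M : 'M[K]_n) : \det (conj_perm s M) = \det M.
Proof.
have -> : conj_perm s M = row_perm s (col_perm s M).
  by apply/matrixP => i j; rewrite !mxE.
rewrite row_permE col_permE !det_mulmx !det_perm odd_permV mulrCA.
by rewrite -expr2 sqrr_sign mulr1.
Qed.

(** In the permutation expansion of a cofactor, conjugating the summation index by [s] preserves its
    sign and matches the terms one by one. *)
Lemma adj_conj_perm n (s : 'S_n) (M : 'M[K]_n) i j :
  \adj (conj_perm s M) i j = \adj M (s i) (s j).
Proof.
rewrite !mxE !expand_cofactor [RHS](reindex_inj (conjg_inj s)) /=.
apply: eq_big => [t|t _]; first by rewrite permJ (inj_eq perm_inj).
rewrite odd_permJ; congr (_ * _); rewrite [RHS](reindex_inj (@perm_inj _ s)) /=.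
by apply: eq_big => [k|k _]; rewrite ?(inj_eq perm_inj) // permJ mxE.
Qed.

Lemma mxtrace_adj_conj n (s : 'S_n) (M : 'M[K]_n) :
  \tr (\adj (conj_perm s M)) = \tr (\adj M).
Proof.
rewrite /mxtrace [RHS](reindex_inj (@perm_inj _ s)) /=.
by apply: eq_bigr => i _; rewrite adj_conj_perm.
Qed.

Lemma adjsum_row_conj n (s : 'S_n) (M : 'M[K]_n) (h : K -> K) i :
  \sum_j h (\adj (conj_perm s M) i j) = \sum_j h (\adj M (s i) j).
Proof.
rewrite [RHS](reindex_inj (@perm_inj _ s)) /=.
by apply: eq_bigr => j _; rewrite adj_conj_perm.
Qed.

Lemma adj_rowsum_conj n (s : 'S_n) (M : 'M[K]_n) i :
  \sum_j \adj (conj_perm s M) i j = \sum_j \adj M (s i) j.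
Proof. exact: (adjsum_row_conj s M id). Qed.

Lemma sumadj_conj n (s : 'S_n) (M : 'M[K]_n) :
  sumadj (conj_perm s M) = sumadj M.
Proof.
rewrite /sumadj [RHS](reindex_inj (@perm_inj _ s)) /=.
by apply: eq_bigr => i _; rewrite adj_rowsum_conj.
Qed.

(** This cycle brings [p] to the front and keeps the other indices in order, so that the minor at
    [ord0] of the conjugated matrix is exactly the minor at [p]. *)
Definition front n (p : 'I_n.+1) : 'S_n.+1 := lift_perm ord0 p 1%g.

Lemma front0 n (p : 'I_n.+1) : front p ord0 = p.
Proof. exact: lift_perm_id. Qed.

Lemma front_lift n (p : 'I_n.+1) k : front p (lift ord0 k) = lift p k.
Proof. by rewrite /front lift_perm_lift perm1. Qed.

(** Induction step for exchangeability: one factor permutes the tail, hence acts inside the inner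
    block, and the other exchanges the first two indices. *)
Lemma front_succ n (j : 'I_n.+1) i : front (lift ord0 j) i =
  lift_perm ord0 ord0 (front j) (tperm ord0 (lift ord0 ord0) i) :> 'I_n.+2.
Proof.
case: (unliftP ord0 i) => [i'|] ->; last first.
  by rewrite tpermL lift_perm_lift !front0.
rewrite front_lift; case: (unliftP ord0 i') => [k|] ->.
  rewrite tpermD // lift_perm_lift front_lift.
  by apply: val_inj; rewrite /= /bump; lia.
by rewrite tpermR lift_perm_id; apply: val_inj.
Qed.

Lemma minor_front n (p : 'I_n.+1) (M : 'M[K]_n.+1) :
  minor ord0 (conj_perm (front p) M) = minor p M.
Proof. by apply/matrixP => i j; rewrite !mxE !front_lift. Qed.

Lemma minor0_bord n a (u : 'rV[K]_n) Z : minor ord0 (bord a u Z) = Z.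
Proof. by apply/matrixP => i j; rewrite !mxE !liftK. Qed.

End Conjugation.

(** * Finite signed measures and exchangeable symmetric matrices *)

Section Quadrature.
Variable K : comNzRingType.

(* A finite signed measure, as a list of weighted points. *)
Definition quad (A : Type) := seq (K * A).

Definition ex A (s : quad A) (F : A -> K) : K := \sum_(p <- s) p.1 * F p.2.

Definition bindq A B (s : quad A) (f : A -> quad B) : quad B :=
  flatten [seq [seq (p.1 * p'.1, p'.2) | p' <- f p.2] | p <- s].

Definition mapq A B (h : A -> B) (s : quad A) : quad B :=
  [seq (p.1, h p.2) | p <- s].

Lemma ex_bind A B (s : quad A) (f : A -> quad B) F :
  ex (bindq s f) F = ex s (fun x => ex (f x) F).
Proof.
rewrite /ex big_flatten big_map; apply: eq_bigr => p _ /=.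
by rewrite big_map mulr_sumr; apply: eq_bigr => p' _; rewrite mulrA.
Qed.

Lemma ex_map A B (h : A -> B) (s : quad A) F : ex (mapq h s) F = ex s (F \o h).
Proof. by rewrite /ex big_map. Qed.

Lemma eq_ex A (s : quad A) (F G : A -> K) : F =1 G -> ex s F = ex s G.
Proof. by move=> FG; apply: eq_bigr => p _; rewrite FG. Qed.

Lemma exD A (s : quad A) F G : ex s (fun x => F x + G x) = ex s F + ex s G.
Proof. by rewrite /ex -big_split; apply: eq_bigr => p _; rewrite mulrDr. Qed.

Lemma exZ A (s : quad A) c F : ex s (fun x => c * F x) = c * ex s F.
Proof. by rewrite /ex mulr_sumr; apply: eq_bigr => p _; rewrite mulrCA. Qed.

Lemma exN A (s : quad A) F : ex s (fun x => - F x) = - ex s F.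
Proof. by rewrite -mulN1r -exZ; apply: eq_ex => x; rewrite mulN1r. Qed.

Lemma ex_sum A (s : quad A) I (r : seq I) (P : pred I) F :
  ex s (fun x => \sum_(i <- r | P i) F i x) =
  \sum_(i <- r | P i) ex s (F i).
Proof.
by rewrite /ex exchange_big; apply: eq_bigr => p _; rewrite mulr_sumr.
Qed.

Lemma ex_swap A B (s : quad A) (t : quad B) F :
  ex s (fun x => ex t (F x)) = ex t (fun y => ex s (F^~ y)).
Proof.
transitivity (\sum_(p <- s) \sum_(p' <- t) p.1 * (p'.1 * F p.2 p'.2)).
  by apply: eq_bigr => p _; rewrite mulr_sumr.
rewrite exchange_big; apply: eq_bigr => p' _; rewrite mulr_sumr.
by apply: eq_bigr => p _; rewrite mulrCA.
Qed.

Variable q : quad K.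

Fixpoint qrow n : quad 'rV[K]_n :=
  if n is m.+1 then bindq (qrow m) (fun u => mapq (fun a => rcons0 a u) q)
  else [:: (1, 0)].

(** Independent entries on and above the diagonal, grown border by border at index [ord0], so that
    averaging over the first row is a mere unfolding. *)
Fixpoint qmat n : quad 'M[K]_n :=
  if n is m.+1 then
    bindq (qmat m) (fun Z => bindq (qrow m) (fun u =>
      mapq (fun a => bord a u Z) q))
  else [:: (1, 0)].

Lemma ex_row0 F : ex (qrow 0) F = F 0.
Proof. by rewrite /ex big_seq1 mul1r. Qed.

Lemma ex_rowS n F :
  ex (qrow n.+1) F = ex (qrow n) (fun u => ex q (fun a => F (rcons0 a u))).
Proof. by rewrite /= ex_bind; apply: eq_ex => u; rewrite ex_map. Qed.

Lemma ex_mat0 F : ex (qmat 0) F = F 0.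
Proof. by rewrite /ex big_seq1 mul1r. Qed.

Lemma ex_matS n F :
  ex (qmat n.+1) F = ex (qmat n) (fun Z => ex (qrow n) (fun u =>
    ex q (fun a => F (bord a u Z)))).
Proof.
rewrite /= ex_bind; apply: eq_ex => Z; rewrite ex_bind.
by apply: eq_ex => u; rewrite ex_map.
Qed.

(** The measure [qmat] is carried by symmetric matrices; this makes symmetry of [Z] available under
    the expectation. *)
Lemma eq_ex_sym n F G : (forall Z, Z^T = Z -> F Z = G Z) ->
  ex (qmat n) F = ex (qmat n) G.
Proof.
elim: n F G => [|n IH] F G FG; first by rewrite !ex_mat0 FG // thinmx0.
rewrite !ex_matS; apply: IH => Z tZ; apply: eq_ex => u; apply: eq_ex => a.
by apply: FG; rewrite tr_bord tZ.
Qed.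

Lemma ex_row_front n (p : 'I_n.+1) F :
  ex (qrow n.+1) (fun u => F (col_perm (front p) u)) = ex (qrow n.+1) F.
Proof.
elim: n p F => [|n IH] p F.
  apply: eq_ex => u; congr F; apply/rowP => i; rewrite mxE; congr (u _ _).
  by rewrite [RHS]ord1 [LHS]ord1.
case: (unliftP ord0 p) => [j|] ->; last first.
  apply: eq_ex => u; congr F; rewrite /front lift_perm1.
  by apply/rowP => i; rewrite mxE perm1.
pose swp (u : 'rV[K]_n.+2) := col_perm (tperm ord0 (lift ord0 ord0)) u.
have ex_swp G : ex (qrow n.+2) (fun u => G (swp u)) = ex (qrow n.+2) G.
  rewrite !ex_rowS; apply: eq_ex => u; rewrite ex_swap.
  apply: eq_ex => a; apply: eq_ex => b; congr G.
  apply/rowP => i; rewrite mxE.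
  case: (unliftP ord0 i) => [i'|] ->; last by rewrite tpermL rcons00 !rcons0_lift rcons00.
  case: (unliftP ord0 i') => [k|] ->; last by rewrite tpermR rcons0_lift !rcons00.
  by rewrite tpermD // !rcons0_lift.
transitivity (ex (qrow n.+2) (fun u =>
    F (swp (col_perm (lift_perm ord0 ord0 (front j)) u)))).
  by apply: eq_ex => u; congr F; apply/rowP => i; rewrite !mxE front_succ.
rewrite -[RHS]ex_swp !(ex_rowS (n := n.+1)).
rewrite -[RHS](IH j); apply: eq_ex => u; apply: eq_ex => a; congr (F (swp _)).
apply/rowP => i; rewrite [LHS]mxE.
case: (unliftP ord0 i) => [k|] ->; first by rewrite lift_perm_lift !rcons0_lift mxE.
by rewrite lift_perm_id !rcons00.
Qed.

Lemma ex_mat_front n (p : 'I_n.+1) F :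
  ex (qmat n.+1) (fun Z => F (conj_perm (front p) Z)) = ex (qmat n.+1) F.
Proof.
elim: n p F => [|n IH] p F.
  apply: eq_ex => Z; congr F; apply/matrixP => i j; rewrite mxE.
  by congr (Z _ _); rewrite [RHS]ord1 [LHS]ord1.
case: (unliftP ord0 p) => [j|] ->; last first.
  apply: eq_ex => Z; congr F; rewrite /front lift_perm1.
  by apply/matrixP => i k; rewrite mxE !perm1.
pose swp (Z : 'M[K]_n.+2) := conj_perm (tperm ord0 (lift ord0 ord0)) Z.
(* The exchange of the first two indices swaps the corners [a], [c] and the rows [u], [v], and fixes
   [b]. All five are averaged independently, so it amounts to reordering finite sums. *)
have ex_swp G : ex (qmat n.+2) (fun Z => G (swp Z)) = ex (qmat n.+2) G.
  rewrite !ex_matS; apply: eq_ex => Z.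
  transitivity (ex (qrow n) (fun v => ex q (fun c => ex (qrow n) (fun u =>
    ex q (fun b => ex q (fun a => G (swp (bord a (rcons0 b u) (bord c v Z))))))))).
    by apply: eq_ex => v; apply: eq_ex => c; rewrite ex_rowS.
  transitivity (ex (qrow n) (fun v => ex q (fun c => ex (qrow n) (fun u =>
    ex q (fun b => ex q (fun a => G (bord a (rcons0 b u) (bord c v Z)))))))); last first.
    by apply: eq_ex => v; apply: eq_ex => c; rewrite ex_rowS.
  transitivity (ex (qrow n) (fun v => ex (qrow n) (fun u => ex q (fun c =>
    ex q (fun b => ex q (fun a => G (swp (bord a (rcons0 b u) (bord c v Z))))))))).
    by apply: eq_ex => v; rewrite ex_swap.
  transitivity (ex (qrow n) (fun v => ex (qrow n) (fun u => ex q (fun c =>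
    ex q (fun b => ex q (fun a => G (bord a (rcons0 b u) (bord c v Z)))))))); last first.
    by apply: eq_ex => v; rewrite ex_swap.
  rewrite ex_swap; apply: eq_ex => u; apply: eq_ex => v.
  transitivity (ex q (fun c => ex q (fun a => ex q (fun b =>
     G (swp (bord a (rcons0 b u) (bord c v Z))))))).
    by apply: eq_ex => c; rewrite ex_swap.
  rewrite ex_swap; apply: eq_ex => a.
  transitivity (ex q (fun b => ex q (fun c =>
     G (swp (bord a (rcons0 b u) (bord c v Z)))))); first exact: ex_swap.
  apply: eq_ex => b; apply: eq_ex => c; congr G.
  have t k : tperm ord0 (lift ord0 ord0) (lift ord0 (lift ord0 k)) =
      lift ord0 (lift ord0 k) :> 'I_n.+2 by rewrite tpermD.
  apply/matrixP => i k; rewrite [LHS]mxE.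
  case: (unliftP ord0 i) => [i'|] ->; case: (unliftP ord0 k) => [j'|] ->;
  rewrite ?tpermL; try (case: (unliftP ord0 i') => [i''|] ->);
  try (case: (unliftP ord0 j') => [j''|] ->);
  by rewrite ?tpermL ?tpermR ?t !bordE ?rcons00 ?rcons0_lift ?bordE.
transitivity (ex (qmat n.+2) (fun Z =>
    F (swp (conj_perm (lift_perm ord0 ord0 (front j)) Z)))).
  by apply: eq_ex => Z; congr F; apply/matrixP => i k; rewrite !mxE !front_succ.
rewrite -[RHS]ex_swp !(ex_matS (n := n.+1)).
rewrite -[RHS](IH j); apply: eq_ex => Z; rewrite -[RHS](ex_row_front j).
apply: eq_ex => u; apply: eq_ex => a; congr (F (swp _)).
apply/matrixP => i k; rewrite [LHS]mxE.
by case: (unliftP ord0 i) => [i'|] ->; case: (unliftP ord0 k) => [k'|] ->;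
  rewrite ?lift_perm_lift ?lift_perm_id !bordE ?mxE.
Qed.

(** Reduces a sum over all indices to its term at [ord0], the index whose row is the border and can
    be averaged directly. *)
Lemma ex_mat_exch n (F : 'I_n.+1 -> 'M[K]_n.+1 -> K) :
  (forall p Z, F ord0 (conj_perm (front p) Z) = F p Z) ->
  ex (qmat n.+1) (fun Z => \sum_p F p Z) = n.+1%:R * ex (qmat n.+1) (F ord0).
Proof.
move=> HF; rewrite ex_sum.
under eq_bigr => p _ do rewrite -(eq_ex _ (HF p)) (ex_mat_front p (F ord0)).
by rewrite sumr_const card_ord mulr_natl.
Qed.

End Quadrature.

(** * Moments of linear and quadratic forms in a random row *)

Section Moments.
Variables (K : comNzRingType) (q : quad K K) (mu2 mu3 mu4 : K).
Hypothesis q0 : ex q (fun=> 1) = 1.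
Hypothesis q1 : ex q id = 0.
Hypothesis q2 : ex q (fun a => a ^+ 2) = mu2.
Hypothesis q3 : ex q (fun a => a ^+ 3) = mu3.
Hypothesis q4 : ex q (fun a => a ^+ 4) = mu4.

Local Notation erow n := (ex (qrow q n)).
Local Notation emat n := (ex (qmat q n)).

(** The constant term is written [c0 * 1] so that linearity exposes the total mass [q0]. *)
Lemma ex_deg4 c0 c1 c2 c3 c4 F :
  (forall a, F a = c0 * 1 + c1 * a + c2 * a ^+ 2 + c3 * a ^+ 3 + c4 * a ^+ 4) ->
  ex q F = c0 + c2 * mu2 + c3 * mu3 + c4 * mu4.
Proof.
move=> EF; rewrite (eq_ex _ EF) !exD !exZ q0 q1 q2 q3 q4; ring.
Qed.

Lemma ex_const c : ex q (fun=> c) = c.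
Proof. by rewrite (@ex_deg4 c 0 0 0 0) => [|a]; ring. Qed.

Lemma erow_const n c : erow n (fun=> c) = c.
Proof.
elim: n => [|n IH]; first by rewrite ex_row0.
by rewrite ex_rowS -[RHS]IH; apply: eq_ex => u; rewrite ex_const.
Qed.

Lemma erow_lform n l : erow n (fun u => lform u l) = 0.
Proof.
elim: n l => [|n IH] l; first by rewrite ex_row0 /lform big_ord0.
rewrite ex_rowS -[RHS](IH (fun i => l (lift ord0 i))).
apply: eq_ex => u; rewrite (@ex_deg4 (lform u (fun i => l (lift ord0 i)))
  (l ord0) 0 0 0) => [|a]; rewrite ?lform_rcons; ring.
Qed.

Lemma erow_lform2 n l m :
  erow n (fun u => lform u l * lform u m) = mu2 * \sum_i l i * m i.
Proof.
elim: n l m => [|n IH] l m.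
  by rewrite ex_row0 /lform !big_ord0 mul0r mulr0.
rewrite ex_rowS big_ord_recl mulrDr.
pose l' i := l (lift ord0 i); pose m' i := m (lift ord0 i).
rewrite -(IH l' m') -[_ * (_ * _)](erow_const n) -exD.
apply: eq_ex => u.
rewrite (@ex_deg4 (lform u l' * lform u m')
  (l ord0 * lform u m' + m ord0 * lform u l') (l ord0 * m ord0) 0 0) => [|a].
  by ring.
by rewrite !lform_rcons; ring.
Qed.

Lemma mxtrace_minor0 n (Z : 'M[K]_n.+1) :
  \tr Z = Z ord0 ord0 + \tr (minor ord0 Z).
Proof.
rewrite /mxtrace big_ord_recl; congr (_ + _).
by apply: eq_bigr => i _; rewrite !mxE.
Qed.

Lemma erow_qform n Z : erow n (fun u => qform u Z) = mu2 * \tr Z.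
Proof.
elim: n Z => [|n IH] Z.
  by rewrite ex_row0 /qform /mxtrace !big_ord0 mulr0.
rewrite ex_rowS mxtrace_minor0 mulrDr -(IH (minor ord0 Z)).
rewrite -[mu2 * _](erow_const n) -exD.
apply: eq_ex => u; pose l j := Z ord0 (lift ord0 j) + Z (lift ord0 j) ord0.
rewrite (@ex_deg4 (qform u (minor ord0 Z)) (lform u l) (Z ord0 ord0) 0 0) => [|a].
  by ring.
by rewrite qform_rcons -/l; ring.
Qed.

(** For centered independent entries, a product of three survives averaging only when the three
    indices coincide, hence only the diagonal of [Z]. *)
Lemma erow_lform_qform n l Z :
  erow n (fun u => lform u l * qform u Z) = mu3 * \sum_i l i * Z i i.
Proof.
elim: n l Z => [|n IH] l Z.
  by rewrite ex_row0 /lform !big_ord0 mul0r mulr0.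
pose l' i := l (lift ord0 i).
pose m j := Z ord0 (lift ord0 j) + Z (lift ord0 j) ord0.
rewrite ex_rowS big_ord_recl mulrDr.
transitivity (erow n (fun u => mu3 * (l ord0 * Z ord0 ord0) +
  (lform u l' * qform u (minor ord0 Z) + (mu2 * l ord0 * lform u m +
   mu2 * Z ord0 ord0 * lform u l')))).
  apply: eq_ex => u.
  rewrite (@ex_deg4 (lform u l' * qform u (minor ord0 Z))
    (l ord0 * qform u (minor ord0 Z) + lform u l' * lform u m)
    (l ord0 * lform u m + lform u l' * Z ord0 ord0) (l ord0 * Z ord0 ord0) 0) => [|a].
    by ring.
  by rewrite qform_rcons lform_rcons -/l' -/m; ring.
rewrite !exD !exZ erow_const !erow_lform !mulr0 !addr0.
rewrite (IH l'); congr (_ + mu3 * _).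
by apply: eq_bigr => i _; rewrite !mxE.
Qed.

(** Wick's formula with a cumulant correction. Of the three pairings of four indices, one gives the
    squared trace and the other two, equal by symmetry of [Z], the sum of squares. When all four
    indices coincide the pairings count [3 * mu2 ^+ 2] in place of [mu4]. *)
Lemma erow_qform2 n (Z : 'M[K]_n) : Z^T = Z ->
  erow n (fun u => qform u Z ^+ 2) =
  (mu4 - 3 * mu2 ^+ 2) * (\sum_i Z i i ^+ 2) +
  mu2 ^+ 2 * ((\tr Z) ^+ 2 + 2 * \sum_i \sum_j Z i j ^+ 2).
Proof.
elim: n Z => [|n IH] Z tZ.
  by rewrite ex_row0 /qform /mxtrace !big_ord0; ring.
pose m j := Z ord0 (lift ord0 j) + Z (lift ord0 j) ord0.
have mE j : m j = 2 * Z ord0 (lift ord0 j).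
  by rewrite /m -{2}tZ mxE; ring.
pose W := minor ord0 Z.
have tW : W^T = W.
  by apply/matrixP => i j; rewrite !mxE -[in RHS]tZ mxE.
rewrite ex_rowS.
transitivity (erow n (fun u => mu4 * Z ord0 ord0 ^+ 2 + (qform u W ^+ 2 +
  (mu2 * (lform u m * lform u m) + (2 * mu3 * Z ord0 ord0 * lform u m +
  2 * mu2 * Z ord0 ord0 * qform u W))))).
  apply: eq_ex => u.
  rewrite (@ex_deg4 (qform u W ^+ 2) (2 * lform u m * qform u W)
    (lform u m * lform u m + 2 * Z ord0 ord0 * qform u W)
    (2 * Z ord0 ord0 * lform u m) (Z ord0 ord0 ^+ 2)) => [|a].
    by ring.
  by rewrite qform_rcons -/m -/W; ring.
rewrite !exD !exZ erow_const erow_lform erow_lform2 erow_qform.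
rewrite (IH W tW) mxtrace_minor0 -/W.
have -> : \sum_i Z i i ^+ 2 = Z ord0 ord0 ^+ 2 + \sum_i W i i ^+ 2.
  by rewrite big_ord_recl; congr (_ + _); apply: eq_bigr => i _; rewrite !mxE.
have -> : \sum_i m i * m i = 4 * \sum_i Z ord0 (lift ord0 i) ^+ 2.
  by rewrite mulr_sumr; apply: eq_bigr => i _; rewrite mE; ring.
have -> : \sum_i \sum_j Z i j ^+ 2 = Z ord0 ord0 ^+ 2 +
    2 * (\sum_i Z ord0 (lift ord0 i) ^+ 2) + \sum_i \sum_j W i j ^+ 2.
  rewrite big_ord_recl big_ord_recl -addrA -addrA; congr (_ + _).
  rewrite mulr_natl mulr2n -addrA; congr (_ + _); rewrite -big_split /=.
  apply: eq_bigr => i _; rewrite big_ord_recl -{1}tZ mxE; congr (_ + _).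
  by apply: eq_bigr => j _; rewrite !mxE.
ring.
Qed.

Lemma lform_adj_bord0 n a (u : 'rV[K]_n) Z :
  \sum_j \adj (bord a u Z) ord0 j =
  \det Z - lform u (fun i => \sum_j \adj Z i j).
Proof.
rewrite big_ord_recl adj_bord00; congr (_ + _).
under eq_bigr do rewrite adj_bord0l.
rewrite sumrN exchange_big; congr (- _).
by apply: eq_bigr => i _; rewrite mulr_sumr.
Qed.

(** * Averages over the border of a matrix *)

Local Notation eborder n F := (erow n (fun u => ex q (fun a => F a u))).

Lemma eborder_det n (Z : 'M[K]_n) :
  eborder n (fun a u => \det (bord a u Z)) = - (mu2 * \tr (\adj Z)).
Proof.
rewrite -erow_qform -exN; apply: eq_ex => u.
by rewrite (@ex_deg4 (- qform u (\adj Z)) (\det Z) 0 0 0) => [|a];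
  rewrite ?det_bord; ring.
Qed.

Lemma erow_qform_col' n (p : 'I_n.+1) (W : 'M[K]_n) :
  erow n.+1 (fun u => qform (col' p u) W) = mu2 * \tr W.
Proof.
rewrite -erow_qform.
transitivity (erow n.+1 (fun u =>
    qform (col' ord0 (col_perm (front p) u)) W)).
  apply: eq_ex => u; congr qform.
  by apply/rowP => i; rewrite !mxE front_lift.
rewrite (ex_row_front q p (fun u => qform (col' ord0 u) W)) ex_rowS.
apply: eq_ex => u; rewrite -[RHS]ex_const; apply: eq_ex => a; congr qform.
by apply/rowP => i; rewrite !mxE liftK.
Qed.

(** The diagonal of the adjugate consists of principal minors: one omits the border and is [\det Z],
    the others are bordered determinants of smaller blocks. *)
Lemma eborder_mxtrace_adj n (Z : 'M[K]_n.+1) :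
  eborder n.+1 (fun a u => \tr (\adj (bord a u Z))) =
  \det Z - mu2 * \sum_p \tr (\adj (minor p Z)).
Proof.
transitivity (erow n.+1 (fun u =>
    \det Z + \sum_p - qform (col' p u) (\adj (minor p Z)))).
  apply: eq_ex => u.
  rewrite (@ex_deg4 (\det Z + \sum_p - qform (col' p u) (\adj (minor p Z)))
    (\sum_p \det (minor p Z)) 0 0 0) => [|a]; first by ring.
  rewrite /mxtrace big_ord_recl adj_bord00.
  rewrite (eq_bigr (fun p => a * \det (minor p Z) -
    qform (col' p u) (\adj (minor p Z)))) => [|p _].
    by rewrite big_split /= -mulr_sumr; ring.
  by rewrite adj_diag minor_bord det_bord.
rewrite exD erow_const ex_sum mulr_sumr -sumrN; congr (_ + _).
by apply: eq_bigr => p _; rewrite exN erow_qform_col'.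
Qed.

Lemma eborder_sumadj n (Z : 'M[K]_n) :
  eborder n (fun a u => sumadj (bord a u Z)) =
  \det Z + mu2 * \tr (minor ord0 (\adj (bord 0 (const_mx 1) Z))).
Proof.
rewrite -erow_qform.
pose V := minor ord0 (\adj (bord 0 (const_mx 1) Z)).
pose r i := \sum_j (\adj Z i j + \adj Z j i).
transitivity (erow n (fun u => \det Z + (- lform u r + qform u V))).
  apply: eq_ex => u.
  rewrite (@ex_deg4 (\det Z + (- lform u r + qform u V)) (sumadj Z) 0 0 0)
    => [|a]; rewrite ?sumadj_bord -/V -/r; ring.
by rewrite !exD exN erow_const erow_lform oppr0 add0r.
Qed.

Lemma mxtrace_adj_bord1 n (Z : 'M[K]_n.+1) :
  \tr (minor ord0 (\adj (bord 0 (const_mx 1) Z))) =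
  - \sum_p sumadj (minor p Z).
Proof.
rewrite -sumrN; apply: eq_bigr => p _; rewrite mxE mxE.
exact: adj_bord1_diag.
Qed.

(** With [p] moved to [ord0], [h] sees only the inner block, and averaging the border turns the
    determinant into a trace of the adjugate. The size drops once more here, which gives the
    recursions below their terms at [n.-1]. *)
Lemma emat_det_minor n (h : 'M[K]_n -> K) :
  emat n.+1 (fun Z => \det Z * \sum_p h (minor p Z)) =
  - (mu2 * n.+1%:R * emat n (fun Z => \tr (\adj Z) * h Z)).
Proof.
transitivity (emat n.+1 (fun Z => \sum_p \det Z * h (minor p Z))).
  by apply: eq_ex => Z; rewrite mulr_sumr.
rewrite (ex_mat_exch q (F := fun p Z => \det Z * h (minor p Z))) => [|p Z].
  rewrite -!mulNr [- mu2 * _]mulrC -mulrA; congr (_ * _); rewrite ex_matS -exZ.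
  apply: eq_ex => Z; transitivity (h Z * - (mu2 * \tr (\adj Z))); last by ring.
  rewrite -eborder_det -exZ; apply: eq_ex => u; rewrite -exZ; apply: eq_ex => a.
  by rewrite minor0_bord mulrC.
by rewrite det_conj_perm minor_front.
Qed.

Lemma emat_mxtrace_exch n (H : 'M[K]_n.+1 -> K) :
  (forall s Z, H (conj_perm s Z) = H Z) ->
  emat n.+1 (fun Z => \tr (\adj Z) * H Z) = n.+1%:R *
  emat n (fun Z => \det Z * eborder n (fun a u => H (bord a u Z))).
Proof.
move=> Hs; transitivity (emat n.+1 (fun Z => \sum_p \adj Z p p * H Z)).
  by apply: eq_ex => Z; rewrite mulr_suml.
rewrite (ex_mat_exch q (F := fun p Z => \adj Z p p * H Z)) => [|p Z].
  rewrite ex_matS; congr (_ * _); apply: eq_ex => Z; rewrite -exZ.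
  apply: eq_ex => u; rewrite -exZ; apply: eq_ex => a.
  by rewrite adj_bord00.
by rewrite Hs adj_conj_perm front0.
Qed.

Lemma emat_row_exch n (H : 'M[K]_n.+1 -> K) :
  (forall s Z, H (conj_perm s Z) = H Z) ->
  emat n.+1 (fun Z => sumadj Z * H Z) = n.+1%:R *
  emat n (fun Z => eborder n (fun a u =>
    (\det Z - lform u (fun i => \sum_j \adj Z i j)) * H (bord a u Z))).
Proof.
move=> Hs; transitivity (emat n.+1 (fun Z => \sum_p (\sum_j \adj Z p j) * H Z)).
  by apply: eq_ex => Z; rewrite mulr_suml.
rewrite (ex_mat_exch q (F := fun p Z => (\sum_j \adj Z p j) * H Z)) => [|p Z].
  rewrite ex_matS; congr (_ * _); apply: eq_ex => Z.
  apply: eq_ex => u; apply: eq_ex => a.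
  by rewrite lform_adj_bord0.
by rewrite Hs adj_rowsum_conj front0.
Qed.

(** * Recursions for the second-order moments of determinant and adjugate *)

Definition Edet2 n := emat n (fun Z => \det Z ^+ 2).
Definition Eadj2 n := emat n (fun Z => \sum_i \sum_j \adj Z i j ^+ 2).
Definition Erow2 n := emat n (fun Z => \sum_i (\sum_j \adj Z i j) ^+ 2).
Definition Etr2 n := emat n (fun Z => \tr (\adj Z) * \tr (\adj Z)).
Definition Etrsum n := emat n (fun Z => \tr (\adj Z) * sumadj Z).
Definition Etrdet n := emat n (fun Z => \tr (\adj Z) * \det Z).
Definition Esumdet n := emat n (fun Z => sumadj Z * \det Z).
Definition Esum2 n := emat n (fun Z => sumadj Z * sumadj Z).

Lemma Edet2_0 : Edet2 0 = 1.
Proof. by rewrite /Edet2 ex_mat0 det_mx00 expr1n. Qed.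

Lemma Eadj2_0 : Eadj2 0 = 0. Proof. by rewrite /Eadj2 ex_mat0 big_ord0. Qed.
Lemma Erow2_0 : Erow2 0 = 0. Proof. by rewrite /Erow2 ex_mat0 big_ord0. Qed.
Lemma Etr2_0 : Etr2 0 = 0.
Proof. by rewrite /Etr2 ex_mat0 /mxtrace big_ord0 mul0r. Qed.
Lemma Etrsum_0 : Etrsum 0 = 0.
Proof. by rewrite /Etrsum ex_mat0 /mxtrace big_ord0 mul0r. Qed.
Lemma Etrdet_0 : Etrdet 0 = 0.
Proof. by rewrite /Etrdet ex_mat0 /mxtrace big_ord0 mul0r. Qed.
Lemma Esumdet_0 : Esumdet 0 = 0.
Proof. by rewrite /Esumdet ex_mat0 /sumadj big_ord0 mul0r. Qed.
Lemma Esum2_0 : Esum2 0 = 0.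
Proof. by rewrite /Esum2 ex_mat0 /sumadj big_ord0 mul0r. Qed.

Lemma Eadj2S n : Eadj2 n.+1 = n.+1%:R * (Edet2 n + mu2 * Eadj2 n).
Proof.
rewrite /Eadj2 (ex_mat_exch q (F := fun p Z => \sum_j \adj Z p j ^+ 2)) => [|p Z].
  rewrite ex_matS; congr (_ * _); rewrite -exZ -exD; apply: eq_ex => Z.
  transitivity (erow n (fun u =>
    \det Z ^+ 2 + \sum_j lform u (fun i => \adj Z i j) * lform u (fun i => \adj Z i j))).
    apply: eq_ex => u; rewrite -[RHS]ex_const; apply: eq_ex => a.
    rewrite big_ord_recl adj_bord00; congr (_ + _).
    by apply: eq_bigr => j _; rewrite adj_bord0l sqrrN expr2.
  rewrite exD erow_const ex_sum; congr (_ + _).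
  rewrite [in RHS]exchange_big mulr_sumr.
  by apply: eq_bigr => j _; rewrite erow_lform2.
by rewrite (adjsum_row_conj _ _ (fun x => x ^+ 2)) front0.
Qed.

Lemma Erow2S n : Erow2 n.+1 = n.+1%:R * (Edet2 n + mu2 * Erow2 n).
Proof.
rewrite /Erow2 (ex_mat_exch q (F := fun p Z => (\sum_j \adj Z p j) ^+ 2)) => [|p Z].
  rewrite ex_matS; congr (_ * _); rewrite -exZ -exD; apply: eq_ex => Z.
  pose r i := \sum_j \adj Z i j.
  transitivity (erow n (fun u =>
    \det Z ^+ 2 + (- (2 * \det Z) * lform u r + lform u r * lform u r))).
    apply: eq_ex => u; rewrite -[RHS]ex_const; apply: eq_ex => a.
    by rewrite lform_adj_bord0 -/r; ring.
  by rewrite !exD erow_const exZ erow_lform mulr0 add0r erow_lform2.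
by rewrite adj_rowsum_conj front0.
Qed.

(** Exchangeability applied to one trace produces [\det Z]; the average of the other trace contains
    minors, to which [emat_det_minor] applies. The factor [n%:R] hides the default value of [n.-1]
    at 0. *)
Lemma Etr2S n :
  Etr2 n.+1 = n.+1%:R * (Edet2 n + mu2 ^+ 2 * n%:R * Etr2 n.-1).
Proof.
rewrite /Etr2 (emat_mxtrace_exch (fun s Z => mxtrace_adj_conj s Z)).
congr (_ * _); case: n => [|n].
  rewrite mulr0 mul0r addr0 /Edet2 !ex_mat0 expr2 ex_row0; congr (_ * _).
  rewrite det_mx00 -[RHS]ex_const; apply: eq_ex => a.
  by rewrite /mxtrace big_ord1 adj_bord00 det_mx00.
transitivity (emat n.+1 (fun Z => \det Z ^+ 2 -
    mu2 * (\det Z * \sum_p \tr (\adj (minor p Z))))).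
  by apply: eq_ex => Z; rewrite eborder_mxtrace_adj; ring.
rewrite exD exN exZ (emat_det_minor (fun W => \tr (\adj W))); congr (_ + _).
by ring.
Qed.

Lemma Etrsum_S n :
  Etrsum n.+1 = n.+1%:R * (Edet2 n + mu2 ^+ 2 * n%:R * Etrsum n.-1).
Proof.
rewrite /Etrsum (emat_mxtrace_exch (fun s Z => sumadj_conj s Z)).
congr (_ * _); case: n => [|n].
  rewrite mulr0 mul0r addr0 /Edet2 !ex_mat0 eborder_sumadj.
  by rewrite /mxtrace big_ord0 mulr0 addr0 expr2.
transitivity (emat n.+1 (fun Z => \det Z ^+ 2 -
    mu2 * (\det Z * \sum_p sumadj (minor p Z)))).
  by apply: eq_ex => Z; rewrite eborder_sumadj mxtrace_adj_bord1; ring.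
rewrite exD exN exZ (emat_det_minor (@sumadj K n)); congr (_ + _).
by ring.
Qed.

(** Averaging the border gives back a multiple of the same quantity one size lower, and in size 0
    the trace is empty. This removes the [mu2] term from [Esumdet_S]. *)
Lemma Etrdet_eq0 n : Etrdet n = 0.
Proof.
elim: n => [|n IH]; first exact: Etrdet_0.
rewrite /Etrdet (emat_mxtrace_exch (fun s Z => det_conj_perm s Z)).
transitivity (n.+1%:R * (- mu2 * Etrdet n)); last by rewrite IH !mulr0.
congr (_ * _); rewrite -exZ.
by apply: eq_ex => Z; rewrite eborder_det; ring.
Qed.

Lemma Edet2S n : Edet2 n.+1 = mu2 * Edet2 n +
  (mu4 - 3 * mu2 ^+ 2) * n%:R * Edet2 n.-1 +
  mu2 ^+ 2 * (Etr2 n + 2 * Eadj2 n).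
Proof.
(* Squared diagonal entries of the adjugate are squared principal minors, all with the same average
   by exchangeability. *)
have diag : emat n (fun Z => \sum_i \adj Z i i ^+ 2) = n%:R * Edet2 n.-1.
  case: n => [|n]; first by rewrite ex_mat0 big_ord0 mul0r.
  rewrite (ex_mat_exch q (F := fun p Z => \adj Z p p ^+ 2)) => [|p Z].
    rewrite ex_matS; congr (_ * _); apply: eq_ex => Z.
    rewrite -[RHS](erow_const n); apply: eq_ex => u.
    by rewrite -[RHS]ex_const; apply: eq_ex => a; rewrite adj_bord00.
  by rewrite adj_conj_perm front0.
rewrite -mulrA -diag /Edet2 ex_matS.
transitivity (emat n (fun Z => mu2 * \det Z ^+ 2 +
  ((mu4 - 3 * mu2 ^+ 2) * (\sum_i \adj Z i i ^+ 2) +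
   mu2 ^+ 2 * (\tr (\adj Z) * \tr (\adj Z) + 2 * \sum_i \sum_j \adj Z i j ^+ 2))));
  last by rewrite !exD !exZ !exD !exZ addrA.
apply: eq_ex_sym => Z tZ.
have tA : (\adj Z)^T = \adj Z by rewrite trmx_adj tZ.
rewrite -expr2 -erow_qform2 // -[X in X + _](erow_const n) -exD.
apply: eq_ex => u.
rewrite (@ex_deg4 (qform u (\adj Z) ^+ 2) (- (2 * \det Z * qform u (\adj Z)))
  (\det Z ^+ 2) 0 0) => [|a]; rewrite ?det_bord; ring.
Qed.

(** The first-row sum of the adjugate is affine in the border row and the bordered determinant
    quadratic; what centering leaves is a trace term, zero by [Etrdet_eq0], and a third-moment
    term. *)
Lemma Esumdet_S n : Esumdet n.+1 = n.+1%:R * (mu3 * n%:R * Edet2 n.-1).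
Proof.
rewrite /Esumdet (emat_row_exch (fun s Z => det_conj_perm s Z)).
congr (_ * _).
have diag : emat n (fun Z => \sum_i (\sum_j \adj Z i j) * \adj Z i i) =
    n%:R * Edet2 n.-1.
  case: n => [|n]; first by rewrite ex_mat0 big_ord0 mul0r.
  rewrite (ex_mat_exch q (F := fun p Z => (\sum_j \adj Z p j) * \adj Z p p)) => [|p Z].
    rewrite ex_matS; congr (_ * _); apply: eq_ex => Z.
    pose r i := \sum_j \adj Z i j.
    transitivity (erow n (fun u => \det Z ^+ 2 + - \det Z * lform u r)).
      apply: eq_ex => u; rewrite -[RHS]ex_const; apply: eq_ex => a.
      by rewrite lform_adj_bord0 adj_bord00 -/r; ring.
    by rewrite exD erow_const exZ erow_lform mulr0 addr0.
  by rewrite adj_rowsum_conj adj_conj_perm front0.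
rewrite -mulrA -diag.
transitivity (emat n (fun Z => - mu2 * (\tr (\adj Z) * \det Z) +
   mu3 * \sum_i (\sum_j \adj Z i j) * \adj Z i i)); last first.
  by rewrite exD !exZ -/(Etrdet n) Etrdet_eq0 mulr0 add0r.
apply: eq_ex => Z; pose r i := \sum_j \adj Z i j.
rewrite -(erow_lform_qform r) mulNr mulrA -erow_qform.
transitivity (erow n (fun u => - \det Z * qform u (\adj Z) +
    lform u r * qform u (\adj Z))).
  apply: eq_ex => u.
  rewrite (@ex_deg4 (- \det Z * qform u (\adj Z) + lform u r * qform u (\adj Z))
    ((\det Z - lform u r) * \det Z) 0 0 0) => [|a]; rewrite ?det_bord -/r; ring.
by rewrite exD exZ mulNr mulrC.
Qed.

Lemma Esum2_S n : Esum2 n.+1 = n.+1%:R * (Edet2 n + 2 * mu2 * Erow2 n +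
  mu2 ^+ 2 * n%:R * Etrsum n.-1 + mu3 * n%:R * Esumdet n.-1).
Proof.
rewrite /Esum2 (emat_row_exch (fun s Z => sumadj_conj s Z)).
congr (_ * _).
(* The diagonal entries of [V Z] are minus the [sumadj] of the principal minors of [Z]; they are the
   source of [Etrsum] and [Esumdet] at [n.-1]. *)
pose V (Z : 'M[K]_n) := minor ord0 (\adj (bord 0 (const_mx 1) Z)).
pose r (Z : 'M[K]_n) i := \sum_j \adj Z i j.
have eV : emat n (fun Z => \det Z * \tr (V Z)) = mu2 * n%:R * Etrsum n.-1.
  rewrite /V; case: (n) => [|m].
    by rewrite ex_mat0 /mxtrace big_ord0 !mulr0 mul0r.
  rewrite -[RHS]opprK -emat_det_minor -exN; apply: eq_ex => Z.
  by rewrite mxtrace_adj_bord1 mulrN.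
have eR : emat n (fun Z => \sum_i r Z i * V Z i i) = - (n%:R * Esumdet n.-1).
  rewrite /V /r; case: (n) => [|m]; first by rewrite ex_mat0 big_ord0 mul0r oppr0.
  transitivity (- emat m.+1 (fun Z =>
    \sum_p (\sum_j \adj Z p j) * sumadj (minor p Z))).
    rewrite -exN; apply: eq_ex => Z; rewrite -sumrN; apply: eq_bigr => p _.
    by rewrite [minor _ _ _ _]mxE [col' _ _ _ _]mxE adj_bord1_diag mulrN.
  rewrite (ex_mat_exch q (F := fun p Z => (\sum_j \adj Z p j) *
    sumadj (minor p Z))) => [|p Z].
    rewrite ex_matS; congr (- (_ * _)); apply: eq_ex => Z.
    transitivity (erow m (fun u => sumadj Z * \det Z +
      - sumadj Z * lform u (fun i => \sum_j \adj Z i j))).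
      apply: eq_ex => u; rewrite -[RHS]ex_const; apply: eq_ex => a.
      by rewrite lform_adj_bord0 minor0_bord; ring.
    by rewrite exD erow_const exZ erow_lform mulr0 addr0.
  by rewrite adj_rowsum_conj front0 minor_front.
have -> : mu2 ^+ 2 * n%:R * Etrsum n.-1 = mu2 * (mu2 * n%:R * Etrsum n.-1) by ring.
have -> : mu3 * n%:R * Esumdet n.-1 = - mu3 * (- (n%:R * Esumdet n.-1)) by ring.
rewrite -eV -eR /Edet2 /Erow2.
transitivity (emat n (fun Z => \det Z ^+ 2 +
  2 * mu2 * (\sum_i (\sum_j \adj Z i j) ^+ 2) +
  mu2 * (\det Z * \tr (V Z)) + - mu3 * (\sum_i r Z i * V Z i i)));
  last by rewrite !exD !exZ.
apply: eq_ex_sym => Z tZ.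
have tA : (\adj Z)^T = \adj Z by rewrite trmx_adj tZ.
(* Symmetry merges row and column sums; this is the 2 in [2 * mu2 * Erow2 n]. *)
have rE i : \sum_j (\adj Z i j + \adj Z j i) = 2 * r Z i.
  rewrite /r mulr_sumr; apply: eq_bigr => j _.
  by rewrite (_ : \adj Z j i = \adj Z i j); [ring | rewrite -{1}tA mxE].
transitivity (erow n (fun u => \det Z ^+ 2 + (- (3 * \det Z) * lform u (r Z) +
  (\det Z * qform u (V Z) + (2 * (lform u (r Z) * lform u (r Z)) +
   - 1 * (lform u (r Z) * qform u (V Z))))))).
  apply: eq_ex => u.
  rewrite (@ex_deg4 (\det Z ^+ 2 + (- (3 * \det Z) * lform u (r Z) +
    (\det Z * qform u (V Z) + (2 * (lform u (r Z) * lform u (r Z)) +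
     - 1 * (lform u (r Z) * qform u (V Z))))))
    ((\det Z - lform u (r Z)) * sumadj Z) 0 0 0) => [|a]; first by ring.
  rewrite sumadj_bord -/(V Z).
  have -> : lform u (fun i => \sum_j (\adj Z i j + \adj Z j i)) = 2 * lform u (r Z).
    by rewrite /lform mulr_sumr; apply: eq_bigr => i _; rewrite rE; ring.
  by rewrite -/(r Z); ring.
rewrite !exD erow_const !exZ erow_lform erow_qform erow_lform2 erow_lform_qform.
rewrite (eq_bigr (fun i => r Z i ^+ 2)) => [|i _]; last by rewrite expr2.
by rewrite /r; ring.
Qed.

Lemma Erow2E n : Erow2 n = Eadj2 n.
Proof.
elim: n => [|n IH]; first by rewrite Erow2_0 Eadj2_0.
by rewrite Erow2S Eadj2S IH.
Qed.

Lemma EtrsumE n : Etrsum n = Etr2 n.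
Proof.
elim/ltn_ind: n => -[|n] IH; first by rewrite Etrsum_0 Etr2_0.
rewrite Etrsum_S Etr2S; case: n IH => [|n] IH; first by rewrite !mulr0 !mul0r.
by rewrite IH.
Qed.

End Moments.

(** Clearing the border of [B] by the row operation [L] adds [c] to every entry of [M]. The corner
    [- c^-1] is chosen to that end, whence the separate case of [c = 0]. *)
Lemma det_add_const (K : fieldType) n (M : 'M[K]_n) c :
  \det (M + const_mx c) = \det M + c * sumadj M.
Proof.
have [->|c0] := eqVneq c 0; first by rewrite mul0r !addr0.
pose B : 'M[K]_(1 + n) := block_mx (- c^-1)%:M (const_mx 1) (const_mx 1) M.
have BE : B = bord (- c^-1) (const_mx 1) M :> 'M[K]_n.+1.
  have o0 : ord0 = lshift n (ord0 : 'I_1) :> 'I_n.+1 by exact: val_inj.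
  have ol k : lift ord0 k = rshift 1 k :> 'I_n.+1 by exact: val_inj.
  apply/matrixP => i j.
  case: (unliftP ord0 i) => [i'|] ->; case: (unliftP ord0 j) => [j'|] ->;
    rewrite bordE ?ol ?o0.
  - exact: block_mxEdr.
  - by rewrite [LHS]block_mxEdl !mxE.
  - by rewrite [LHS]block_mxEur !mxE.
  - by rewrite [LHS]block_mxEul !mxE.
pose L : 'M[K]_(1 + n) := block_mx 1%:M 0 (const_mx c) 1%:M.
have LB : L *m B = block_mx (- c^-1)%:M (const_mx 1) 0 (M + const_mx c).
  rewrite mulmx_block !mul1mx !mul0mx !addr0; congr block_mx.
    apply/matrixP => i j; rewrite !mxE big_ord1 !mxE !ord1 mulr1n.
    by rewrite mulrN mulfV // addNr.
  apply/matrixP => i j; rewrite !mxE big_ord1 !mxE mulr1; ring.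
have := congr1 determinant LB.
rewrite det_mulmx det_lblock det_ublock !det1 !mul1r BE det_bord det_scalar1.
have -> : qform (const_mx 1) (\adj M) = sumadj M.
  by apply: eq_bigr => i _; apply: eq_bigr => j _; rewrite !mxE !mul1r.
move=> E; have := congr1 ( *%R (- c)) E.
rewrite mulrBr !mulrA mulrNN mulfV // !mul1r mulNr opprK => ->.
by [].
Qed.

(** * Differentiation of formal power series and the generating functions *)

Section FpsDerivative.
Variable K : numFieldType.
Implicit Types (f g h u : fps K) (a : K).

Definition fder f : fps K := Fps (fun n => n.+1%:R * fcoef f n.+1).

(** Leibniz's rule is inherited from polynomials. Coefficient [n] of a derivative involves
    coefficient [n.+1] of the series, which fixes the truncation order. *)
Lemma fderM f g : fder (f * g) = fder f * g + f * fder g.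
Proof.
apply/fpsP => n; pose p := ftrunc n.+1 f; pose q := ftrunc n.+1 g.
have E h i : (i <= n)%N -> (ftrunc n.+1 h)^`()`_i = fcoef (fder h) i.
  by move=> ni; rewrite coef_deriv coef_ftrunc //= mulr_natl.
have tr h i : (i <= n)%N -> (ftrunc n.+1 h)`_i = fcoef h i.
  by move=> ni; rewrite coef_ftrunc // ltnW.
rewrite fcoefD -(@fmul_trunc _ n p^`() q) //; [|exact: E|exact: tr].
rewrite -(@fmul_trunc _ n p q^`()) //; [|exact: tr|exact: E].
rewrite -coefD -derivM coef_deriv -mulr_natl; congr (_ * _).
by symmetry; apply: (@fmul_trunc _ n.+1) => // i; apply: coef_ftrunc.
Qed.

Lemma fderD f g : fder (f + g) = fder f + fder g.
Proof. by apply/fpsP => n /=; rewrite mulrDr. Qed.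

Lemma fderZ a f : fder (a *: f) = a *: fder f.
Proof. by apply/fpsP => n /=; rewrite mulrCA. Qed.

Lemma fderN f : fder (- f) = - fder f.
Proof. by apply/fpsP => n /=; rewrite mulrN. Qed.

Lemma fder1 : fder 1 = 0.
Proof. by apply/fpsP => n /=; rewrite mulr0. Qed.

Lemma fderX : fder fX = 1.
Proof. by apply/fpsP => -[|n] /=; rewrite ?mulr1 ?mulr0. Qed.

Lemma fderXn u k : fder (u ^+ k.+1) = k.+1%:R *: (u ^+ k * fder u).
Proof.
elim: k => [|k IH]; first by rewrite expr1 expr0 mul1r scale1r.
rewrite exprS fderM IH -[k.+2]addn1 natrD scalerDl scale1r addrC.
by rewrite -scalerAr mulrA -exprS mulrC.
Qed.

Lemma fcompD h g u : fcomp (h + g) u = fcomp h u + fcomp g u.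
Proof.
apply/fpsP => n /=; rewrite -big_split; apply: eq_bigr => k _.
by rewrite mulrDl.
Qed.

Lemma fcompZ a h u : fcomp (a *: h) u = a *: fcomp h u.
Proof.
by apply/fpsP => n /=; rewrite mulr_sumr; apply: eq_bigr => k _; rewrite mulrA.
Qed.

Lemma fcoef_fXM h n : fcoef (fX * h) n.+1 = fcoef h n.
Proof.
rewrite fcoefM big_ord_recl /= mul0r add0r big_ord_recl /= mul1r subSS subn0.
by rewrite big1 ?addr0 // => i _; rewrite /= mul0r.
Qed.

Lemma fcoef_fXM0 h : fcoef (fX * h) 0 = 0.
Proof. by rewrite fcoefM0 mul0r. Qed.

(* For a composition, only the partial sum up to degree [n] matters. *)
Lemma fcoef_mul_fcomp h u g n : fcoef u 0 = 0 ->
  fcoef (g * fcomp h u) n =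
  fcoef (g * \sum_(k < n.+1) fcoef h k *: u ^+ k) n.
Proof.
move=> u0; rewrite !fcoefM; apply: eq_bigr => i _; congr (_ * _).
by apply: fcompE; rewrite ?leq_subr.
Qed.

(** Together with linearity in the outer series, this carries a linear differential equation with
    coefficients of degree at most one through the substitution of [u]. *)
Lemma fcomp_fXM h u : fcoef u 0 = 0 -> fcomp (fX * h) u = u * fcomp h u.
Proof.
move=> u0; apply/fpsP => n.
rewrite fcoef_mul_fcomp // mulr_sumr fcoef_sum.
have E k : fcoef (u * (fcoef h k *: u ^+ k)) n = fcoef h k * fcoef (u ^+ k.+1) n.
  by rewrite -scalerAr -exprS.
under eq_bigr => k _ do rewrite E.
rewrite [RHS]big_ord_recr /= fcoef_exp_lt // mulr0 addr0.
rewrite -[LHS]/(\sum_(k < n.+1) fcoef (fX * h) k * fcoef (u ^+ k) n).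
rewrite big_ord_recl fcoef_fXM0 mul0r add0r.
by apply: eq_bigr => i _; rewrite fcoef_fXM.
Qed.

Lemma fder_fcomp h u : fcoef u 0 = 0 ->
  fder (fcomp h u) = fder u * fcomp (fder h) u.
Proof.
move=> u0; apply/fpsP => n; rewrite fcoef_mul_fcomp //.
rewrite [LHS]/= -[X in _ * X]/(fcoef (fcomp h u) n.+1) (@fcompE _ _ _ _ n.+1) //.
rewrite -[LHS]/(fcoef (fder (\sum_(k < n.+2) fcoef h k *: u ^+ k)) n).
congr fcoef; rewrite (big_morph fder fderD (_ : fder 0 = 0)); last first.
  by apply/fpsP => m /=; rewrite mulr0.
rewrite big_ord_recl expr0 fderZ fder1 scaler0 add0r mulr_sumr.
apply: eq_bigr => i _; rewrite fderZ fderXn scalerA -scalerAr.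
by rewrite [fcoef _ _ * _]mulrC [u ^+ i * _]mulrC.
Qed.

Lemma fder_fexp u : fcoef u 0 = 0 -> fder (fexp u) = fder u * fexp u.
Proof.
move=> u0; rewrite fder_fcomp //; congr (_ * fcomp _ _); apply/fpsP => n /=.
by rewrite factS natrM invfM mul1r mulVKf ?pnatr_eq0 ?mul1r.
Qed.

(** Coefficientwise, [fisqrt1m_rec] says that Newton's series [h] satisfies [2 (1 - x) h' = h]; the
    chain rule then gives the equation after substitution. *)
Lemma fder_frsqrt1m u : fcoef u 0 = 0 ->
  2 *: (fder (frsqrt1m u) * (1 - u)) = fder u * frsqrt1m u.
Proof.
move=> u0; rewrite /frsqrt1m fder_fcomp // -mulrA scalerAr; congr (_ * _).
set g := fder _; rewrite mulrBr mulr1 [_ * u]mulrC -fcomp_fXM // -[- _]scaleN1r.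
rewrite -fcompZ -fcompD -fcompZ; congr fcomp; apply/fpsP => n.
have E := fisqrt1m_rec K n; rewrite fcoefZ fcoefD fcoefZ /g.
case: n E => [|n] E.
  rewrite fcoef_fXM0 mulr0 addr0 -[RHS]mulr1 -[RHS]E.
  rewrite -[fcoef (fder _) 0]/(1%:R * fcoef _ 1); ring.
rewrite fcoef_fXM -[fcoef (fder _) n.+1]/(n.+2%:R * fcoef _ _).
rewrite -[fcoef (fder _) n]/(n.+1%:R * fcoef _ _).
apply: (@etrans _ _ (fcoef (fisqrt1m K) n.+1 * n.+1.*2.+1%:R -
  2 * (n.+1%:R * fcoef (fisqrt1m K) n.+1))).
  by rewrite -E -mulr_natl; ring.
by rewrite -natr1 -muln2 natrM; ring.
Qed.

(* Multiplied out, so that no quotient of series is differentiated. *)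
Lemma fps_ode_uniq (A N f g : fps K) : fcoef A 0 != 0 ->
  A * fder f = N * f -> A * fder g = N * g -> fcoef f 0 = fcoef g 0 -> f = g.
Proof.
move=> A0 fE gE f0.
have E : fder (f - g) = A^-1 * N * (f - g).
  rewrite fderD fderN -mulrA mulrBr -fE -gE -mulrBr.
  by rewrite mulrA mulVr ?mul1r // fps_unitE.
have : forall n, fcoef (f - g) n = 0.
  elim/ltn_ind=> -[|n] IH; first by rewrite fcoefB f0 subrr.
  have : fcoef (fder (f - g)) n = 0.
    rewrite E fcoefM big1 // => i _; rewrite IH ?mulr0 //.
    by rewrite ltnS leq_subr.
  by rewrite /= => /eqP; rewrite mulf_eq0 pnatr_eq0 => /eqP.
by move=> E0; apply/eqP; rewrite -subr_eq0; apply/eqP/fpsP => n; rewrite E0.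
Qed.

Lemma fcoef_fcomp0 h u : fcoef (fcomp h u) 0 = fcoef h 0.
Proof. by rewrite /= big_ord1 expr0 fcoef1 mulr1. Qed.

(** The factor [n.+1%:R] that exchangeability produces becomes multiplication by the variable. *)
Lemma egf_shift (a g : nat -> K) : a 0%N = 0 ->
  (forall n, a n.+1 = n.+1%:R * g n) -> egf a = fX * egf g.
Proof.
move=> a0 aS; apply/fpsP => -[|n]; first by rewrite fcoef_fXM0 /= a0 mul0r.
rewrite fcoef_fXM /= aS factS natrM invfM mulrACA.
by rewrite mulfV ?mul1r ?pnatr_eq0.
Qed.

Lemma fder_egf (a : nat -> K) : fder (egf a) = egf (fun n => a n.+1).
Proof.
apply/fpsP => n /=; rewrite factS natrM invfM mulrCA mulVKf //.
Qed.

Lemma egfD (a b : nat -> K) : egf (fun n => a n + b n) = egf a + egf b.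
Proof. by apply/fpsP => n /=; rewrite mulrDl. Qed.

Lemma egfZ c (a : nat -> K) : egf (fun n => c * a n) = c *: egf a.
Proof. by apply/fpsP => n /=; rewrite mulrA. Qed.

(* The recursions satisfied by [Edet2], [Eadj2], [Etr2], [Esumdet] and [Esum2]. *)
Lemma gf_solution (m mu2 mu3 mu4 : K) (f S Q b c : nat -> K) :
  let t : fps K := fX in
  f 0%N = 1 -> S 0%N = 0 -> Q 0%N = 0 -> b 0%N = 0 -> c 0%N = 0 ->
  (forall n, f n.+1 = mu2 * f n + (mu4 - 3 * mu2 ^+ 2) * n%:R * f n.-1 +
     mu2 ^+ 2 * (Q n + 2 * S n)) ->
  (forall n, S n.+1 = n.+1%:R * (f n + mu2 * S n)) ->
  (forall n, Q n.+1 = n.+1%:R * (f n + mu2 ^+ 2 * n%:R * Q n.-1)) ->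
  (forall n, b n.+1 = n.+1%:R * (mu3 * n%:R * f n.-1)) ->
  (forall n, c n.+1 = n.+1%:R * (f n + 2 * mu2 * S n +
     mu2 ^+ 2 * n%:R * Q n.-1 + mu3 * n%:R * b n.-1)) ->
  egf (fun n => f n + 2 * m * b n + m ^+ 2 * c n) =
    (1 + (2 * m * mu3) *: t ^+ 2
       + m ^+ 2 *: (mu3 ^+ 2 *: t ^+ 4
                     + t / (1 - mu2 ^+ 2 *: t ^+ 2)
                     + (2 * mu2) *: t ^+ 2 / (1 - mu2 *: t)))
    * (fexp (((mu4 - 3 * mu2 ^+ 2) / 2) *: t ^+ 2 - mu2 *: t)
       / (1 - mu2 *: t) ^+ 2
       * frsqrt1m (mu2 ^+ 2 *: t ^+ 2)).
Proof.
move=> t f0 S0 Q0 b0 c0 fS SS QS bS cS.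
set k := mu4 - 3 * mu2 ^+ 2 in fS *.
pose C : {rmorphism K -> fps K} := in_alg (fps K).
have ZE a g : a *: g = C a * g by rewrite mulr_algl.
have shift1 (a : nat -> K) : egf (fun n => n%:R * a n.-1) = t * egf a.
  by apply: egf_shift => [|n]; rewrite ?mul0r.
set F := egf f; pose GS := egf S; pose GQ := egf Q; pose B := egf b.
pose u2 := mu2 ^+ 2 *: t ^+ 2; pose A := 1 - mu2 *: t.
have t0 : fcoef t 0 = 0 by [].
have u20 : fcoef u2 0 = 0 by rewrite fcoefZ expr2 fcoefM0 t0 !mulr0.
have uA : A \is a GRing.unit.
  by rewrite fps_unitE fcoefB fcoefZ t0 mulr0 subr0 oner_eq0.
have uU : 1 - u2 \is a GRing.unit by rewrite fps_unitE fcoefB u20 subr0 oner_eq0.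
have SE : GS * A = t * F.
  have E : GS = t * (F + C mu2 * GS).
    by rewrite -ZE -egfZ -egfD; exact: egf_shift.
  by rewrite mulrBr mulr1 {1}E ZE; ring.
have QE : GQ * (1 - u2) = t * F.
  have E : GQ = t * (F + C (mu2 ^+ 2) * (t * GQ)).
    rewrite -shift1 -ZE -egfZ -egfD; apply: egf_shift => // n.
    by rewrite QS -!mulrA.
  by rewrite mulrBr mulr1 {1}E /u2 ZE; ring.
have BE : B = C mu3 * t ^+ 2 * F.
  have -> : B = t * (C mu3 * (t * F)).
    rewrite -shift1 -ZE -egfZ; apply: egf_shift => // n.
    by rewrite bS -!mulrA.
  by ring.
have CE : egf c = t * F + C (2 * mu2) * t * GS + C (mu2 ^+ 2) * t ^+ 2 * GQ +
    C mu3 * t ^+ 2 * B.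
  have -> : egf c = t * (F + C (2 * mu2) * GS + C (mu2 ^+ 2) * (t * GQ) +
      C mu3 * (t * B)).
    rewrite -!shift1 -!ZE -!egfZ -!egfD; apply: egf_shift => // n.
    by rewrite cS -!mulrA.
  by ring.
have FE : fder F = C mu2 * F + C k * (t * F) + C (mu2 ^+ 2) * (GQ + C 2 * GS).
  rewrite -!shift1 -!ZE -!egfZ -!egfD -egfZ -!egfD fder_egf; congr egf.
  by apply/funext => n; rewrite fS -!mulrA.
pose G := fexp ((k / 2) *: t ^+ 2 - mu2 *: t) / A ^+ 2 * frsqrt1m u2.
have FG : F = G.
  (* [N] is [A * (1 - u2)] times the logarithmic derivative [mu2 + k t + mu2^2 (t / (1 - u2) + 2 t /
     A)] given by [FE], [QE] and [SE]. As [2 mu2^2 t / A = 2 mu2 / A - 2 mu2], it integrates to [k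
     t^2 / 2 - mu2 t - 2 log A - log (1 - u2) / 2], the logarithm of [G]. *)
  pose N := C mu2 * A * (1 - u2) + C k * t * A * (1 - u2) +
    C (mu2 ^+ 2) * (t * A + C 2 * t * (1 - u2)).
  have w0 : fcoef ((k / 2) *: t ^+ 2 - mu2 *: t) 0 = 0.
    by rewrite fcoefB !fcoefZ expr2 fcoefM0 t0 !mulr0 subr0.
  have dt : fder t = 1 by exact: fderX.
  have dt2 : fder (t ^+ 2) = C 2 * t.
    by rewrite fderXn dt mulr1 expr1 ZE.
  apply: (@fps_ode_uniq (A * (1 - u2)) N).
  - by rewrite -fps_unitE unitrM uA uU.
  - have -> : A * (1 - u2) * fder F = C mu2 * A * (1 - u2) * F +
      C k * t * A * (1 - u2) * F + C (mu2 ^+ 2) * (A * (GQ * (1 - u2)) +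
      C 2 * (1 - u2) * (GS * A)) by rewrite FE; ring.
    by rewrite SE QE /N; ring.
  - set r := frsqrt1m u2 in G *; pose e := fexp ((k / 2) *: t ^+ 2 - mu2 *: t).
    have k2 : C (k / 2) * C 2 = C k by rewrite -(rmorphM C) divfK ?pnatr_eq0.
    have eE : fder e = (C k * t - C mu2) * e.
      by rewrite fder_fexp // -/e fderD fderN !fderZ dt dt2 !ZE -k2; ring.
    have rE : (1 - u2) * fder r = C (mu2 ^+ 2) * t * r.
      have := fder_frsqrt1m u20; rewrite fderZ dt2 !ZE -/r => E.
      have u2' : C 2 \is a GRing.unit.
        by apply: rmorph_unit; rewrite unitfE pnatr_eq0.
      by apply: (mulrI u2'); rewrite [_ * fder r]mulrC E; ring.
    have GE : G * A ^+ 2 = e * r by rewrite /G -/e mulrAC divrK ?unitrX.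
    have dA : fder A = - C mu2.
      by rewrite fderD fderN fderZ dt fder1 ZE mulr1 sub0r.
    have dGE : fder G * A ^+ 2 - C 2 * C mu2 * A * G =
        fder e * r + e * fder r.
      by rewrite -fderM -GE fderM fderXn dA ZE expr1; ring.
    (* The extra factor [A] makes [fder G * A ^+ 2] appear, which [dGE] expresses without
       inverses. *)
    apply: (mulIr uA).
    have -> : A * (1 - u2) * fder G * A =
      (1 - u2) * (fder G * A ^+ 2 - C 2 * C mu2 * A * G) +
      C 2 * C mu2 * (1 - u2) * A * G by ring.
    rewrite dGE eE.
    have -> : (1 - u2) * ((C k * t - C mu2) * e * r + e * fder r) =
      ((1 - u2) * (C k * t - C mu2)) * (e * r) + e * ((1 - u2) * fder r) by ring.
    rewrite rE.
    have -> : ((1 - u2) * (C k * t - C mu2)) * (e * r) + e * (C (mu2 ^+ 2) * t * r) =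
      ((1 - u2) * (C k * t - C mu2) + C (mu2 ^+ 2) * t) * (e * r) by ring.
    by rewrite -GE /N /A ZE; ring.
  - rewrite !fcoefM0 !fcoef_fcomp0 /= f0 !fact0 divr1 mul1r.
    have -> : fcoef (A ^+ 2)^-1 0 = 1.
      have := congr1 (fun g => fcoef g 0) (mulVr (unitrX 2 uA)).
      rewrite fcoefM0 expr2 fcoefM0 fcoefB fcoefZ t0 mulr0 subr0 !mulr1.
      by rewrite -expr2.
    by rewrite mulr1.
rewrite -/u2 -/A -/G -FG !egfD !egfZ CE !ZE -/F -/B.
set iU := (1 - u2)^-1; set iA := A^-1.
have QI : t * iU * F = GQ by rewrite mulrAC -QE mulrK.
have SI : t * iA * F = GS by rewrite mulrAC -SE mulrK.
(* With the bare [t * F] written through [GQ], the sum [t * F + u2 * GQ] collapses to [GQ]; [ring]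
   treats [iU] as opaque and would miss this cancellation. *)
have -> : t * F = GQ * (1 - u2) by rewrite QE.
rewrite BE -QI -SI /u2 ZE; ring.
Qed.

End FpsDerivative.

(** * Expectation of a product of functions of independent variables *)

Section Independence.
Context d (T : measurableType d) (R : realType) (P : probability T R).
Local Open Scope ereal_scope.
Import HBNNSimple.

Lemma cvg_integral_nondecreasing d' (T' : measurableType d')
    (mu : {measure set T' -> \bar R}) (u : nat -> T' -> \bar R) (h : T' -> \bar R) :
  (forall n, measurable_fun setT (u n)) -> (forall n x, 0 <= u n x) ->
  (forall m n x, (m <= n)%N -> u m x <= u n x) ->
  (forall x, u n x @[n --> \oo] --> h x) ->
  \int[mu]_x u n x @[n --> \oo] --> \int[mu]_x h x.
Proof.
move=> mu_ u0 nd uh.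
rewrite (eq_integral (fun x => limn (u ^~ x))) => [|x _]; last first.
  by apply/esym/cvg_lim => //; exact: uh.
by apply: cvg_monotone_convergence => // x _ m n mn; exact: nd.
Qed.

(** Simple functions and monotone convergence extend the factorization from indicators to
    nonnegative [g]. The weight [W] stands for the product of all other factors. *)
Lemma ge0_integral_mul_indep (mu : {finite_measure set (measurableTypeR R) -> \bar R})
    (W : T -> R) (Y : T -> measurableTypeR R) (g : measurableTypeR R -> R) :
  measurable_fun setT W -> (forall x, 0 <= W x)%R -> measurable_fun setT Y ->
  measurable_fun setT g -> (forall y, 0 <= g y)%R ->
  \int[P]_x (W x)%:E < +oo ->
  (forall B : set R, measurable B ->
    \int[P]_x (W x * \1_B (Y x))%:E = \int[P]_x (W x)%:E * mu B) ->
  \int[P]_x (W x * g (Y x))%:E = \int[P]_x (W x)%:E * \int[mu]_y (g y)%:E.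
Proof.
move=> mW W0 mY mg g0 Woo HB.
have [c c0 cE] : exists2 c : R, (0 <= c)%R & \int[P]_x (W x)%:E = c%:E.
  have W00 : 0 <= \int[P]_x (W x)%:E by apply: integral_ge0 => x _; rewrite lee_fin.
  exists (fine (\int[P]_x (W x)%:E)); first exact: fine_ge0.
  by rewrite fineK // ge0_fin_numE.
rewrite cE in HB *.
have mg' : measurable_fun setT (EFin \o g) by exact/measurable_EFinP.
pose s := nnsfun_approx measurableT mg'.
have ms n : measurable_fun setT (s n) by exact: measurable_funP.
have step n : \int[P]_x (W x * s n (Y x))%:E = c%:E * \int[mu]_y (s n y)%:E.
  pose A := fset_set (range (s n)).
  pose ind (r : R) (y : measurableTypeR R) : R := \1_(s n @^-1` [set r]) y.
  have mpre r : measurable (s n @^-1` [set r]) by exact: measurable_funPTI.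
  have mind r : measurable_fun setT (ind r).
    exact: measurable_indic.
  have ind0 r y : (0 <= ind r y)%R by rewrite /ind indicE ler0n.
  (* The values of [s n] are nonnegative, so the absolute values change nothing; they make each term
     nonnegative for every real [r], as termwise integration requires. *)
  have sE y : s n y = (\sum_(r <- A) `|r| * ind r y)%R.
    rewrite fimfunE fsbig_finite //=.
    rewrite big_seq [RHS]big_seq; apply: eq_bigr => r.
    by rewrite in_fset_set // => /set_mem[z _ <-]; rewrite ger0_norm.
  transitivity (\sum_(r <- A) `|r|%:E * (c%:E * mu (s n @^-1` [set r]))).
    transitivity (\int[P]_x \sum_(r <- A) (`|r|%:E * (W x * ind r (Y x))%:E)).
      apply: eq_integral => x _; rewrite sE mulr_sumr -sumEFin.
      by apply: eq_bigr => r _; rewrite -EFinM mulrCA.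
    have mWi r : measurable_fun setT (fun x => (W x * ind r (Y x))%:E).
      apply/measurable_EFinP; apply: measurable_funM => //.
      exact: (measurableT_comp (mind r) mY).
    rewrite ge0_integral_sum //=.
    - apply: eq_bigr => r _; rewrite ge0_integralZl_EFin //; last first.
        by move=> x _; rewrite lee_fin mulr_ge0.
      by congr (_ * _); exact: (HB _ (mpre r)).
    - by move=> r; apply: measurable_funeM.
    - by move=> r x _; rewrite mule_ge0 // lee_fin mulr_ge0.
  transitivity (c%:E * \int[mu]_y \sum_(r <- A) (`|r|%:E * (ind r y)%:E)).
    rewrite ge0_integral_sum //=.
    - rewrite ge0_sume_distrr; last first.
        by move=> r _; apply: integral_ge0 => y _; rewrite mule_ge0 // lee_fin.
      apply: eq_bigr => r _; rewrite ge0_integralZl_EFin //.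
      + rewrite (_ : \int[mu]_y (ind r y)%:E = mu (s n @^-1` [set r])); last first.
          by rewrite (integral_indic mu measurableT (mpre r)) setIT.
        by rewrite muleCA.
      + by move=> y _; rewrite lee_fin.
      + exact/measurable_EFinP.
    - by move=> r; apply: measurable_funeM; exact/measurable_EFinP.
    - by move=> r x _; rewrite mule_ge0 // lee_fin.
  by congr (_ * _); apply: eq_integral => y _; rewrite sE -sumEFin.
have cvs y : (s n y)%:E @[n --> \oo] --> (g y)%:E.
  by apply: (@cvg_nnsfun_approx _ _ _ _ measurableT _ mg' _ y) => // z _; rewrite lee_fin.
have nds m n : (m <= n)%N -> forall y, (s m y <= s n y)%R.
  by move=> mn; apply/lefP; exact: nd_nnsfun_approx.
have L : \int[P]_x (W x * s n (Y x))%:E @[n --> \oo] -->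
    \int[P]_x (W x * g (Y x))%:E.
  apply: cvg_integral_nondecreasing => [n|n x|m n x mn|x].
  - apply/measurable_EFinP/measurable_funM => //.
    exact: (measurableT_comp (ms n) mY).
  - by rewrite lee_fin mulr_ge0.
  - by rewrite lee_fin ler_wpM2l // nds.
  - by rewrite EFinM; under eq_fun do rewrite EFinM; apply: cvgeZl => //; exact: cvs.
suff L' : \int[P]_x (W x * s n (Y x))%:E @[n --> \oo] -->
    c%:E * \int[mu]_y (g y)%:E by exact: (cvg_unique _ L L').
rewrite (_ : (fun n => _) = fun n => c%:E * \int[mu]_y (s n y)%:E); last first.
  by apply/funext => n; exact: step.
apply: cvgeZl => //; apply: cvg_integral_nondecreasing => // [n|n y|m n y mn].
- exact/measurable_EFinP.
- by rewrite lee_fin.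
- by rewrite lee_fin nds.
Qed.

Variables (mu : probability (measurableTypeR R) R) (I : finType).
Variable Y : I -> T -> measurableTypeR R.
Hypothesis mY : forall i, measurable_fun setT (Y i).
Hypothesis lawY : forall i (B : set (measurableTypeR R)), measurable B ->
  P (Y i @^-1` B) = mu B.
Hypothesis indepY : mutually_independent P (fun i => Y i : T -> R).

Definition moment (g : measurableTypeR R -> R) : R := fine (\int[mu]_y (g y)%:E).

Lemma momentE g : mu.-integrable setT (EFin \o g) ->
  (moment g)%:E = \int[mu]_y (g y)%:E.
Proof. by move=> ig; rewrite fineK //; exact: integrable_fin_num. Qed.

Lemma moment_indic (B : set (measurableTypeR R)) : measurable B ->
  (moment \1_B)%:E = mu B.
Proof.
move=> mB; rewrite momentE ?integral_indic ?setIT //.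
exact: integrable_indic.
Qed.

Lemma measurable_prod_comp (Q : pred I) (g : I -> measurableTypeR R -> R) :
  (forall i, measurable_fun setT (g i)) ->
  measurable_fun setT (fun x => (\prod_(i | Q i) g i (Y i x))%R).
Proof.
move=> mg; under eq_fun do rewrite big_mkcond; apply: measurable_prod => i _.
by case: (Q i) => //; exact: (measurableT_comp (mg i) (mY i)).
Qed.

Lemma integral_prod_indic (B : I -> set (measurableTypeR R)) :
  (forall i, measurable (B i)) ->
  \int[P]_x (\prod_i (\1_(B i) (Y i x) : R))%:E = (\prod_i moment \1_(B i))%:E.
Proof.
move=> mB; pose J : {set I} := [set: I]%SET.
pose C := \bigcap_(i in [set` J]) (Y i @^-1` B i).
rewrite (eq_integral (fun x => (\1_C x)%:E)).
  rewrite integral_indic ?setIT //; last first.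
    apply: fin_bigcap_measurable => // i _.
    by rewrite -[_ @^-1` _]setTI; exact: mY.
  transitivity (\prod_(i in J) P (Y i @^-1` B i)); first exact: (indepY J mB).
  rewrite -prodEFin.
  by apply: eq_big => [i|i _]; rewrite ?inE // moment_indic // lawY.
move=> x _; congr (_%:E); rewrite [RHS]indicE.
case: (boolP (x \in C)) => [/set_mem Cx|/negP Cx].
  by apply: big1 => i _; rewrite indicE mem_set //; apply: Cx => /=; rewrite inE.
have [i Bi] : exists i, ~ B i (Y i x).
  apply: contrapT => H; apply: Cx; apply/mem_set => i _ /=.
  by apply: contrapT => Bi; apply: H; exists i.
by rewrite (bigD1 i) //= indicE memNset // mul0r.
Qed.

(** Indicators give way to the [g i] one index at a time. Keeping [B] general in the induction lets
    the set at the new index [k] vary, which is the hypothesis of [ge0_integral_mul_indep] there. *)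
Lemma ge0_integral_prod_partial (s : seq I) (B : I -> set (measurableTypeR R))
    (g : I -> measurableTypeR R -> R) :
  (forall i, measurable (B i)) ->
  (forall i, mu.-integrable setT (EFin \o g i)) -> (forall i y, 0 <= g i y)%R ->
  let h i := if i \in s then g i else \1_(B i) in
  \int[P]_x (\prod_i h i (Y i x))%:E = (\prod_i moment (h i))%:E.
Proof.
move=> mB ig g0; elim: s B mB => [|k s IH] B mB; first exact: integral_prod_indic.
pose h (B : I -> set (measurableTypeR R)) i := if i \in s then g i else \1_(B i).
have mh B' i : (forall i, measurable (B' i)) -> measurable_fun setT (h B' i).
  move=> mB'; rewrite /h; case: ifP => _; last exact: measurable_indic.
  by have /integrableP[/measurable_EFinP] := ig i.
have h0 B' i y : (0 <= h B' i y)%R by rewrite /h; case: ifP => _ //; rewrite indicE ler0n.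
have [ks|ks] := boolP (k \in s).
  move=> H; have -> : H = h B by apply/funext => i; rewrite /H /h inE;
    case: eqP => // ->; rewrite ks.
  exact: IH.
pose Bk (A : set (measurableTypeR R)) i := if i == k then A else B i.
have mBk A : measurable A -> forall i, measurable (Bk A i).
  by move=> mA i; rewrite /Bk; case: ifP.
pose W x := (\prod_(i | i != k) h B i (Y i x))%R.
have WE A x : (\prod_i h (Bk A) i (Y i x) = W x * \1_A (Y k x))%R.
  rewrite (bigD1 k) //= mulrC; congr (_ * _)%R.
    by apply: eq_bigr => i /negbTE ik; rewrite /h /Bk ik.
  by rewrite /h /Bk (negbTE ks) eqxx.
pose c := (\prod_(i | i != k) moment (h B i))%R.
have cE A : measurable A -> \int[P]_x (W x * \1_A (Y k x))%:E = c%:E * mu A.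
  move=> mA; under eq_integral => x _ do rewrite -WE.
  rewrite (IH (Bk A) (mBk A mA)) (bigD1 k) //= mulrC EFinM; congr (_%:E * _).
    by apply: eq_bigr => i /negbTE ik; rewrite /h /Bk ik.
  by rewrite (negbTE ks) /Bk eqxx moment_indic.
have WcE : \int[P]_x (W x)%:E = c%:E.
  rewrite -[RHS]mule1 -(@probability_setT _ _ _ mu) -cE //.
  by apply: eq_integral => x _; rewrite indicE in_setT mulr1.
move=> H; have Hk : H k = g k by rewrite /H in_cons eqxx.
have Hi i : i != k -> H i = h B i by rewrite /H /h in_cons => /negbTE->.
transitivity (\int[P]_x (W x * g k (Y k x))%:E).
  apply: eq_integral => x _; rewrite (bigD1 k) //= mulrC Hk.
  by congr (_ * _)%:E; apply: eq_bigr => i /Hi ->.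
rewrite (@ge0_integral_mul_indep mu) //.
- rewrite WcE -momentE // -EFinM (bigD1 k) //= Hk mulrC.
  by congr (_ * _)%:E; apply: eq_bigr => i /Hi ->.
- by apply: measurable_prod_comp => i; exact: mh.
- by move=> x; apply: prodr_ge0 => i _.
- by have /integrableP[/measurable_EFinP] := ig k.
- by rewrite WcE ltry.
- by move=> A mA; rewrite WcE; exact: cE.
Qed.

Lemma ge0_integral_prod (g : I -> measurableTypeR R -> R) :
  (forall i, mu.-integrable setT (EFin \o g i)) -> (forall i y, 0 <= g i y)%R ->
  \int[P]_x (\prod_i g i (Y i x))%:E = (\prod_i moment (g i))%:E.
Proof.
move=> ig g0; pose h i := if i \in enum I then g i else \1_setT.
have <- : h = g by apply/funext => i; rewrite /h mem_enum.
exact: (@ge0_integral_prod_partial (enum I) (fun=> setT)).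
Qed.

Lemma integrable_prod (g : I -> measurableTypeR R -> R) :
  (forall i, mu.-integrable setT (EFin \o g i)) ->
  P.-integrable setT (fun x => (\prod_i g i (Y i x))%:E).
Proof.
move=> ig; apply/integrableP; split.
  apply/measurable_EFinP; apply: measurable_prod_comp => i.
  by have /integrableP[/measurable_EFinP] := ig i.
rewrite (eq_integral (fun x => (\prod_i `|g i (Y i x)|)%:E)); last first.
  by move=> x _; rewrite /= normr_prod.
rewrite (@ge0_integral_prod (fun i y => `|g i y|%R)) ?ltry // => i.
by have := integrable_abse (ig i).
Qed.

Lemma integral_prod (g : I -> measurableTypeR R -> R) :
  (forall i, mu.-integrable setT (EFin \o g i)) ->
  \int[P]_x (\prod_i g i (Y i x))%:E = (\prod_i moment (g i))%:E.
Proof.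
(* [s] lists the indices whose factor may change sign. Each step splits one such factor into
   positive and negative parts and recombines them by linearity. *)
move: g; suff H (s : seq I) : forall g : I -> measurableTypeR R -> R,
    (forall i, mu.-integrable setT (EFin \o g i)) ->
    (forall i y, i \notin s -> 0 <= g i y)%R ->
    \int[P]_x (\prod_i g i (Y i x))%:E = (\prod_i moment (g i))%:E.
  by move=> g ig; apply: (H (enum I)) => // i y; rewrite mem_enum.
elim: s => [|k s IH] g ig g0.
  by apply: ge0_integral_prod => // i y; exact: g0.
pose f (p : measurableTypeR R -> R) i := if i == k then p else g i.
pose gp y := Order.max (g k y) 0%R; pose gn y := Order.max (- g k y)%R 0%R.
have gE y : g k y = (gp y - gn y)%R.
  by rewrite /gp /gn; case: (leP (g k y) 0%R) => gk; case: (leP (- g k y)%R 0%R) => gk';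
    lra.
have mgk : measurable_fun setT (g k).
  by have /integrableP[/measurable_EFinP] := ig k.
have le_int (p : measurableTypeR R -> R) : measurable_fun setT p ->
    (forall y, `|p y| <= `|g k y|)%R -> mu.-integrable setT (EFin \o p).
  move=> mp pg; apply: (le_integrable measurableT _ _ (ig k)).
    exact/measurable_EFinP.
  by move=> y _; rewrite /= lee_fin.
have igp : mu.-integrable setT (EFin \o gp).
  apply: le_int => [|y]; first exact: measurable_maxr.
  by rewrite /gp; case: (leP (g k y) 0%R) => h; rewrite ?normr0 ?normr_ge0.
have ign : mu.-integrable setT (EFin \o gn).
  apply: le_int => [|y]; first by apply: measurable_maxr => //; exact: measurable_funN.
  by rewrite /gn; case: (leP (- g k y)%R 0%R) => h; rewrite ?normr0 ?normrN ?normr_ge0.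
have if_ p : mu.-integrable setT (EFin \o p) ->
    forall i, mu.-integrable setT (EFin \o f p i).
  by move=> ip i; rewrite /f; case: ifP.
have fE p : mu.-integrable setT (EFin \o p) -> (forall y, 0 <= p y)%R ->
    \int[P]_x (\prod_i f p i (Y i x))%:E =
    (moment p * \prod_(i | i != k) moment (g i))%:E.
  move=> ip p0; rewrite IH.
  - rewrite (bigD1 k) //= /f eqxx; congr (_ * _)%:E.
    by apply: eq_bigr => i /negbTE ->.
  - exact: if_.
  - move=> i y is_; rewrite /f; case: eqP => [_|/eqP ik]; first exact: p0.
    by apply: g0; rewrite in_cons negb_or ik.
transitivity (\int[P]_x ((\prod_i f gp i (Y i x))%:E - (\prod_i f gn i (Y i x))%:E)).
  apply: eq_integral => x _; rewrite -EFinB; congr (_%:E).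
  rewrite (bigD1 k) //= gE mulrBl [X in (_ = X - _)%R](bigD1 k) //=.
  rewrite [X in (_ = _ - X)%R](bigD1 k) //= /f !eqxx.
  by congr (_ * _ - _ * _)%R; apply: eq_bigr => i /negbTE ->.
rewrite integralB_EFin //=; try by apply: integrable_prod; exact: if_.
rewrite !fE //; try by move=> y; rewrite /gp /gn le_max lexx orbT.
rewrite -EFinB -mulrBl [in RHS](bigD1 k) //=.
congr (_ * _)%:E; apply: EFin_inj.
rewrite EFinB !momentE // -integralB_EFin //.
by apply: eq_integral => y _; rewrite gE.
Qed.

End Independence.

(** * Factorization of the matrix quadrature over its upper triangle *)

Section Quadrature_products.
Variables (K : comNzRingType) (q : quad K K).

Lemma ex_row_prod n (g : 'I_n -> K -> K) :
  ex (qrow q n) (fun u => \prod_j g j (u 0 j)) = \prod_j ex q (g j).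
Proof.
elim: n g => [|n IH] g; first by rewrite ex_row0 !big_ord0.
rewrite ex_rowS big_ord_recl -(IH (fun j => g (lift ord0 j))) -exZ.
apply: eq_ex => u; rewrite mulrC -exZ; apply: eq_ex => a.
rewrite big_ord_recl rcons00 mulrC; congr (_ * _).
by apply: eq_bigr => j _; rewrite rcons0_lift.
Qed.

Lemma prod_upper_recl n (F : 'I_n.+1 -> 'I_n.+1 -> K) :
  \prod_(p : 'I_n.+1 * 'I_n.+1 | (p.1 <= p.2)%N) F p.1 p.2 =
  F ord0 ord0 * (\prod_j F ord0 (lift ord0 j)) *
  \prod_(p : 'I_n * 'I_n | (p.1 <= p.2)%N) F (lift ord0 p.1) (lift ord0 p.2).
Proof.
rewrite -(pair_big_dep xpredT (fun i j : 'I_n.+1 => (i <= j)%N)).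
rewrite big_ord_recl big_ord_recl /=.
congr (_ * _).
rewrite -(pair_big_dep xpredT (fun i j : 'I_n => (i <= j)%N)
  (fun i j => F (lift ord0 i) (lift ord0 j))).
by apply: eq_bigr => i _; rewrite big_mkcond big_ord_recl /= mul1r -big_mkcond.
Qed.

Lemma ex_mat_prod n (h : 'I_n -> 'I_n -> K -> K) :
  ex (qmat q n) (fun Z => \prod_(p : 'I_n * 'I_n | (p.1 <= p.2)%N)
    h p.1 p.2 (Z p.1 p.2)) =
  \prod_(p : 'I_n * 'I_n | (p.1 <= p.2)%N) ex q (h p.1 p.2).
Proof.
elim: n h => [|n IH] h; first by rewrite ex_mat0 !big1 // => -[[]].
rewrite ex_matS (prod_upper_recl (fun i j => ex q (h i j))).
rewrite -(IH (fun i j => h (lift ord0 i) (lift ord0 j))) -exZ.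
apply: eq_ex => Z; rewrite -(ex_row_prod (fun j => h ord0 (lift ord0 j))).
rewrite mulrAC -exZ; apply: eq_ex => u; rewrite -mulrA mulrC -exZ.
apply: eq_ex => a.
rewrite (prod_upper_recl (fun i j => h i j (bord a u Z i j))) bord00.
rewrite [RHS]mulrC [X in _ = _ * X]mulrC mulrA; congr (_ * _ * _).
  by apply: eq_bigr => j _; rewrite bordE.
by apply: eq_bigr => p _; rewrite bordE.
Qed.

End Quadrature_products.

(** * Squared determinant as a polynomial in the upper triangular entries *)

Section DetSquareExpansion.
Variable K : comNzRingType.

Definition ordered_pair n (i j : 'I_n) := if (i <= j)%N then (i, j) else (j, i).

(** The exponent of the entry at [p] in the Leibniz term of [s], once the positions [(i, j)] and
    [(j, i)] are identified. *)
Definition pair_mult n (s : 'S_n) (p : 'I_n * 'I_n) : nat :=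
  #|[pred i | ordered_pair i (s i) == p]|.

(** Only the rows [p.1] and [p.2] can contribute. Hence exponents in a squared determinant are at
    most 4, and moments up to the fourth decide its expectation. *)
Lemma pair_mult_le2 n (s : 'S_n) p : (pair_mult s p <= 2)%N.
Proof.
rewrite (leq_trans (subset_leq_card (B := [set p.1; p.2]%SET) _)) //; last first.
  by rewrite cards2; case: eqP.
apply/fintype.subsetP => i; rewrite !inE /ordered_pair => /eqP <-.
by case: ifP => _ /=; rewrite eqxx ?orbT.
Qed.

Lemma prod_perm_upper n (s : 'S_n) (M : 'M[K]_n) : M^T = M ->
  \prod_i M i (s i) =
  \prod_(p : 'I_n * 'I_n | (p.1 <= p.2)%N) M p.1 p.2 ^+ pair_mult s p.
Proof.
move=> tM; have sM i j : M i j = M j i by rewrite -{1}tM mxE.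
rewrite (partition_big (fun i => ordered_pair i (s i))
  (fun p : 'I_n * 'I_n => (p.1 <= p.2)%N)) => [|i _]; last first.
  by rewrite /ordered_pair; case: (leqP i (s i)) => //= /ltnW.
apply: eq_bigr => p _; rewrite -prodr_const.
apply: eq_big => [i|i /eqP <-]; first by rewrite !inE.
by rewrite /ordered_pair; case: ifP => _ /=.
Qed.

Lemma det_sqr_upper n (M : 'M[K]_n) : M^T = M ->
  \det M ^+ 2 = \sum_(st : 'S_n * 'S_n) ((-1) ^+ st.1 * (-1) ^+ st.2) *
    \prod_(p : 'I_n * 'I_n | (p.1 <= p.2)%N)
      M p.1 p.2 ^+ (pair_mult st.1 p + pair_mult st.2 p).
Proof.
move=> tM; rewrite expr2 /determinant big_distrlr /= pair_bigA /=.
apply: eq_bigr => st _; rewrite !prod_perm_upper // mulrACA -big_split /=.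
by congr (_ * _); apply: eq_bigr => p _; rewrite exprD.
Qed.

End DetSquareExpansion.

(** * A five-point signed measure with prescribed moments *)

Section FivePoints.
Variable K : numFieldType.

(* The weights on the nodes -2, -1, 0, 1, 2 are obtained by Lagrange
   interpolation, for the moments 1, 0, mu2, mu3, mu4. *)
Definition five_point (mu2 mu3 mu4 : K) : quad K K :=
  [:: ((mu4 - 2 * mu3 - mu2) / 24, - 2); ((4 * mu2 - mu4 + mu3) / 6, - 1);
      ((mu4 - 5 * mu2 + 4) / 4, 0); ((4 * mu2 - mu4 - mu3) / 6, 1);
      ((mu4 + 2 * mu3 - mu2) / 24, 2)].

Lemma ex_five_point mu2 mu3 mu4 (F : K -> K) : ex (five_point mu2 mu3 mu4) F =
  (mu4 - 2 * mu3 - mu2) / 24 * F (- 2) + (4 * mu2 - mu4 + mu3) / 6 * F (- 1) +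
  (mu4 - 5 * mu2 + 4) / 4 * F 0 + (4 * mu2 - mu4 - mu3) / 6 * F 1 +
  (mu4 + 2 * mu3 - mu2) / 24 * F 2.
Proof. by rewrite /ex !big_cons big_nil addr0 /= !addrA. Qed.

Variables mu2 mu3 mu4 : K.
Let q := five_point mu2 mu3 mu4.

Lemma five_point0 : ex q (fun=> 1) = 1.
Proof. by rewrite ex_five_point; field. Qed.
Lemma five_point1 : ex q id = 0.
Proof. by rewrite ex_five_point; field. Qed.
Lemma five_point2 : ex q (fun a => a ^+ 2) = mu2.
Proof. by rewrite ex_five_point; field. Qed.
Lemma five_point3 : ex q (fun a => a ^+ 3) = mu3.
Proof. by rewrite ex_five_point; field. Qed.
Lemma five_point4 : ex q (fun a => a ^+ 4) = mu4.
Proof. by rewrite ex_five_point; field. Qed.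

End FivePoints.

(** * Passing from the law of the entries to the five-point measure *)

Section FourMoments.
Variables (R : realType) (D : probability (measurableTypeR R) R).
Hypothesis D4 : D.-integrable [set: R] (fun x : R => (x ^+ 4)%:E).

Let pw k : measurableTypeR R -> R := fun x => x ^+ k.
Let raw k : R := moment D (pw k).

Lemma integrable_pow k : (k <= 4)%N -> D.-integrable setT (EFin \o pw k).
Proof.
move=> k4; have i1 : D.-integrable setT (EFin \o cst (1 : R)).
  exact: finite_measure_integrable_cst.
apply: (le_integrable measurableT _ _ (integrableD measurableT i1 D4)).
  by apply/measurable_EFinP; exact: exprn_measurable.
move=> x _; suff: `|x ^+ k| <= `|1 + x ^+ 4| by rewrite -lee_fin.
rewrite [leRHS]ger0_norm; last by rewrite addr_ge0 // exprn_even_ge0.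
have -> : x ^+ 4 = `|x| ^+ 4 by rewrite -normrX ger0_norm // exprn_even_ge0.
rewrite normrX; case: (leP `|x| 1) => x1.
  by rewrite ler_wpDr ?exprn_ge0 // exprn_ile1.
by rewrite ler_wpDl // ler_weXn2l // ltW.
Qed.

Lemma moment_poly4 (c : 'I_5 -> R) (g : measurableTypeR R -> R) :
  (forall x, g x = \sum_k c k * x ^+ k) ->
  moment D g = \sum_k c k * raw k.
Proof.
move=> gE; apply: EFin_inj; rewrite -sumEFin.
have ik (k : 'I_5) : D.-integrable setT (fun x => ((c k)%:E * (pw k x)%:E)%E).
  by apply: integrableZl => //; apply: integrable_pow; rewrite -ltnS.
have gE' : EFin \o g = fun x => (\sum_(k < 5) (c k)%:E * (pw k x)%:E)%E.
  by apply/funext => x /=; rewrite gE -sumEFin; apply: eq_bigr.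
have ig : D.-integrable setT (EFin \o g).
  by rewrite gE'; apply: integrable_sum => // k _; exact: ik.
rewrite momentE // -[X in integral _ _ X]/(EFin \o g) gE' integral_sum //.
apply: eq_bigr => k _; rewrite integralZl //; last first.
  by apply: integrable_pow; rewrite -ltnS.
by rewrite EFinM momentE //; apply: integrable_pow; rewrite -ltnS.
Qed.

Lemma raw0 : raw 0 = 1.
Proof.
apply: EFin_inj; rewrite momentE ?integrable_pow //.
rewrite (eq_integral (cst 1%E)) // integral_cst // mul1e.
exact: probability_setT.
Qed.

Lemma mean_raw : mean D = raw 1.
Proof. by rewrite /mean unlock. Qed.

Lemma central_momentE k : central_moment D k = moment D (fun x => (x - raw 1) ^+ k).
Proof. by rewrite /central_moment unlock -mean_raw. Qed.

Let cf (c0 c1 c2 c3 c4 : R) : 'I_5 -> R := nth 0 [:: c0; c1; c2; c3; c4].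

Lemma central_moment2E : central_moment D 2 = raw 2 - raw 1 ^+ 2.
Proof.
rewrite central_momentE (@moment_poly4 (cf (raw 1 ^+ 2) (- 2 * raw 1) 1 0 0)).
  by rewrite !big_ord_recl big_ord0 /cf /= raw0; ring.
by move=> x; rewrite !big_ord_recl big_ord0 /cf /=; ring.
Qed.

Lemma central_moment3E :
  central_moment D 3 = raw 3 - 3 * raw 1 * raw 2 + 2 * raw 1 ^+ 3.
Proof.
rewrite central_momentE
  (@moment_poly4 (cf (- raw 1 ^+ 3) (3 * raw 1 ^+ 2) (- 3 * raw 1) 1 0)).
  by rewrite !big_ord_recl big_ord0 /cf /= raw0; ring.
by move=> x; rewrite !big_ord_recl big_ord0 /cf /=; ring.
Qed.

Lemma central_moment4E : central_moment D 4 =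
  raw 4 - 4 * raw 1 * raw 3 + 6 * raw 1 ^+ 2 * raw 2 - 3 * raw 1 ^+ 4.
Proof.
rewrite central_momentE (@moment_poly4
  (cf (raw 1 ^+ 4) (- 4 * raw 1 ^+ 3) (6 * raw 1 ^+ 2) (- 4 * raw 1) 1)).
  by rewrite !big_ord_recl big_ord0 /cf /= raw0; ring.
by move=> x; rewrite !big_ord_recl big_ord0 /cf /=; ring.
Qed.

Let q := five_point (central_moment D 2) (central_moment D 3) (central_moment D 4).

(** The measure [q] agrees with the centered law up to order 4, so its translate by the mean has the
    raw moments of [D]. *)
Lemma ex_five_point_shift k : (k <= 4)%N ->
  ex q (fun y => (y + mean D) ^+ k) = raw k.
Proof.
rewrite mean_raw /q ex_five_point.
rewrite central_moment2E central_moment3E central_moment4E.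
by case: k => [|[|[|[|[|k]]]]] // _; rewrite ?raw0; field.
Qed.

(** The common value of the two expectations, over the probability space and over the quadrature;
    the law enters through [raw] alone. *)
Definition det2_moment_sum n : R :=
  \sum_(st : 'S_n * 'S_n) ((-1) ^+ st.1 * (-1) ^+ st.2) *
    \prod_(p : 'I_n * 'I_n | (p.1 <= p.2)%N)
      raw (pair_mult st.1 p + pair_mult st.2 p).

Lemma pair_mult_add_le4 n (s t : 'S_n) p : (pair_mult s p + pair_mult t p <= 4)%N.
Proof. exact: (leq_add (pair_mult_le2 s p) (pair_mult_le2 t p)). Qed.

Lemma ex_det2 n :
  ex (qmat q n) (fun Z => \det (Z + const_mx (mean D)) ^+ 2) = det2_moment_sum n.
Proof.
transitivity (ex (qmat q n) (fun Z => \sum_(st : 'S_n * 'S_n)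
    ((-1) ^+ st.1 * (-1) ^+ st.2) * \prod_(p : 'I_n * 'I_n | (p.1 <= p.2)%N)
      (Z p.1 p.2 + mean D) ^+ (pair_mult st.1 p + pair_mult st.2 p))).
  apply: eq_ex_sym => Z tZ; rewrite det_sqr_upper; last first.
    by rewrite linearD /= tZ trmx_const.
  apply: eq_bigr => st _; congr (_ * _); apply: eq_bigr => p _.
  by rewrite !mxE.
rewrite ex_sum; apply: eq_bigr => st _; rewrite exZ; congr (_ * _).
pose h i j y := (y + mean D) ^+ (pair_mult st.1 (i, j) + pair_mult st.2 (i, j)).
transitivity (\prod_(p : 'I_n * 'I_n | (p.1 <= p.2)%N) ex q (h p.1 p.2)).
  rewrite -(ex_mat_prod q h); apply: eq_ex => Z.
  by apply: eq_bigr => -[i j] _.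
apply: eq_bigr => -[i j] _; apply: ex_five_point_shift.
exact: pair_mult_add_le4.
Qed.

Lemma expectation_det_sqr d (T : measurableType d) (P : probability T R) n
    (X : 'I_n -> 'I_n -> {RV P >-> R}) : symmetric_iid D X ->
  ('E_P[det_sqr X] = (det2_moment_sum n)%:E)%E.
Proof.
move=> [sX lX iX]; rewrite unlock.
pose I := {p : 'I_n * 'I_n | (p.1 <= p.2)%N}.
pose Y (p : I) : T -> measurableTypeR R := X (val p).1 (val p).2.
have mY p : measurable_fun setT (Y p) by exact: (measurable_funP (X (val p).1 (val p).2)).
have lY p (B : set (measurableTypeR R)) : measurable B -> P (Y p @^-1` B) = D B.
  by move=> mB; exact: (lX _ _ B (valP p)).
pose e (st : 'S_n * 'S_n) (p : I) := (pair_mult st.1 (val p) + pair_mult st.2 (val p))%N.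
have ie st p : D.-integrable setT (EFin \o pw (e st p)).
  by apply: integrable_pow; exact: pair_mult_add_le4.
pose sg (st : 'S_n * 'S_n) : R := (-1) ^+ st.1 * (-1) ^+ st.2.
have E x : (det_sqr X x)%:E =
    (\sum_(st : 'S_n * 'S_n) (sg st)%:E * (\prod_p pw (e st p) (Y p x))%:E)%E.
  rewrite /det_sqr det_sqr_upper; last first.
    by apply/matrixP => i j; rewrite !mxE sX.
  rewrite -sumEFin; apply: eq_bigr => st _; rewrite -EFinM; congr (_ * _)%:E.
  rewrite (big_sub [pred p : 'I_n * 'I_n | (p.1 <= p.2)%N]).
  by apply: eq_bigr => p _; rewrite mxE.
have ip st := @integrable_prod _ T R P D I Y mY lY iX _ (ie st).
rewrite (eq_integral _ _ (fun x _ => E x)) integral_sum //; last first.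
  by move=> st; apply: integrableZl.
rewrite /det2_moment_sum -sumEFin; apply: eq_bigr => st _.
rewrite integralZl // (integral_prod mY lY iX (ie st)) -EFinM; congr (_ * _)%:E.
by rewrite (big_sub [pred p : 'I_n * 'I_n | (p.1 <= p.2)%N]).
Qed.

End FourMoments.

Lemma det2_moment_sumE (R : realType) (D : probability (measurableTypeR R) R)
    (q := five_point (central_moment D 2) (central_moment D 3) (central_moment D 4)) n :
  D.-integrable [set: R] (fun x : R => (x ^+ 4)%:E) ->
  det2_moment_sum D n =
  Edet2 q n + 2 * mean D * Esumdet q n + mean D ^+ 2 * Esum2 q n.
Proof.
move=> D4; rewrite -(ex_det2 D4) /Edet2 /Esumdet /Esum2 -!exZ -!exD.
by apply: eq_ex => Z; rewrite det_add_const; ring.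
Qed.

Theorem theorem9 (R : realType)
    (D : probability (measurableTypeR R) R)
    (D4 : D.-integrable [set: R] (fun x : R => (x ^+ 4)%:E))
    (d : nat -> measure_display) (T : forall n : nat, measurableType (d n))
    (P : forall n : nat, probability (T n) R)
    (X : forall n : nat, 'I_n -> 'I_n -> {RV (P n) >-> R})
    (iidX : forall n : nat, symmetric_iid D (X n)) :
  let m1 := mean D in
  let mu2 := central_moment D 2 in
  let mu3 := central_moment D 3 in
  let mu4 := central_moment D 4 in
  let f2 := fun n : nat => fine ('E_(P n)[det_sqr (X n)])%E in
  let t : fps R := fX in
  (forall n : nat, ('E_(P n)[det_sqr (X n)])%E \is a fin_num) /\
  egf f2 =
    (1 + (2 * m1 * mu3) *: t ^+ 2
       + m1 ^+ 2 *: (mu3 ^+ 2 *: t ^+ 4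
                     + t / (1 - mu2 ^+ 2 *: t ^+ 2)
                     + (2 * mu2) *: t ^+ 2 / (1 - mu2 *: t)))
    * (fexp (((mu4 - 3 * mu2 ^+ 2) / 2) *: t ^+ 2 - mu2 *: t)
       / (1 - mu2 *: t) ^+ 2
       * frsqrt1m (mu2 ^+ 2 *: t ^+ 2)).
Proof.
move=> m1 mu2 mu3 mu4 f2 t.
have E n : ('E_(P n)[det_sqr (X n)] = (det2_moment_sum D n)%:E)%E.
  exact: expectation_det_sqr.
split=> [n|]; first by rewrite E.
pose q := five_point mu2 mu3 mu4.
pose q0 := five_point0 mu2 mu3 mu4; pose q1 := five_point1 mu2 mu3 mu4.
pose q2 := five_point2 mu2 mu3 mu4; pose q3 := five_point3 mu2 mu3 mu4.
pose q4 := five_point4 mu2 mu3 mu4.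
have -> : f2 = fun n => Edet2 q n + 2 * m1 * Esumdet q n + m1 ^+ 2 * Esum2 q n.
  by apply/funext => n; rewrite /f2 E /= det2_moment_sumE.
apply: (@gf_solution _ m1 mu2 mu3 mu4 _ (Eadj2 q) (Etr2 q)) => [||||||n|n|n|n].
- exact: Edet2_0.
- exact: Eadj2_0.
- exact: Etr2_0.
- exact: Esumdet_0.
- exact: Esum2_0.
- exact: (Edet2S q0 q1 q2 q3 q4).
- exact: (Eadj2S q0 q1 q2 q3 q4).
- exact: (Etr2S q0 q1 q2 q3 q4).
- exact: (Esumdet_S q0 q1 q2 q3 q4).
(* [gf_solution] has [Eadj2] and [Etr2] where the recursion of [Esum2] has [Erow2] and [Etrsum]; the
   latter agree with them by equality of recursions. *)
- rewrite -(Erow2E q0 q1 q2 q3 q4) -(EtrsumE q0 q1 q2 q3 q4).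
  exact: (Esum2_S q0 q1 q2 q3 q4).
Qed.
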